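(* There is an algorithm for $\gamma$-Colorful $k$-Center that, on every instance, returns a set of centers $C\subseteq X$ with $|C|\le k$ that is a feasible solution of radius at most $4r^*$, where $r^*$ is the optimal radius of the instance (i.e. a $4$-approximation algorithm), and whose running time is $|X|^{O(\gamma)}$.
   Context: $\gamma$-Colorful $k$-Center: given integers $\gamma,k\ge 1$, a finite metric space $(X,d)$, subsets (''colors'') $X_\ell\subseteq X$ for $\ell\in[\gamma]$, and $m\in\mathbb{Z}_{\ge 0}^\gamma$, find the smallest radius $r\ge 0$ together with centers $C\subseteq X$, $|C|\le k$, such that $|B(C,r)\cap X_\ell|\ge m_\ell$ for all $\ell\in[\gamma]$. Here $B(c,r)=\{u\in X: d(c,u)\le r\}$ and $B(C,r)=\bigcup_{c\in C}B(c,r)$. Such $C$ is called a solution of radius $r$. An element may have several colors or none. *)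

(* Defs.v *)
From HB Require Import structures.
From mathcomp Require Import all_boot all_order all_algebra.
From mathcomp Require Import all_classical all_reals topology.

Set Implicit Arguments.
Unset Strict Implicit.
Unset Printing Implicit Defensive.

Import Order.TTheory GRing.Theory Num.Theory.
Local Open Scope ring_scope.

#[short(type="finMetricType")]
HB.structure Definition FinMetric (K : numDomainType) :=
  { T of Metric K T & Finite T }.

Record instance (R : realType) := Instance {
  ncolors : nat;
  ncolors_gt0 : (0 < ncolors)%N;
  ncenters : nat;
  ncenters_gt0 : (0 < ncenters)%N;
  points : finMetricType R;
  color : 'I_ncolors -> {set points};
  demand : 'I_ncolors -> nat
}.

Definition ball_of (R : realType) (X : finMetricType R) (C : {set X}) (r : R) :
    {set X} :=
  \bigcup_(c in C) [set u | mdist c u <= r].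

Definition solution (R : realType) (I : instance R) (r : R)
    (C : {set points I}) : Prop :=
  [/\ 0 <= r, (#|C| <= ncenters I)%N
    & forall l, (demand l <= #|ball_of C r :&: color l|)%N].

(* No radius is optimal when the instance has no solution at all, i.e. when
   some color has fewer elements than its demand. *)
Definition optimal_radius (R : realType) (I : instance R) (r : R) : Prop :=
  (exists C, @solution R I r C) /\
  (forall r' C, @solution R I r' C -> r <= r').

(* Algorithms are programs for a random access machine with unbounded natural
   numbers and real numbers, each kind having directly addressed registers and
   an indirectly addressed array (addresses are natural registers).  Every
   instruction and every test costs one unit of time.
   Since numbers grow without bound at unit cost, the arithmetic is limited to
   operations that lengthen naturals by at most one bit per step (there is no
   multiplication): up to polynomial factors this machine is then no faster
   than a Turing machine.  Reals can only be added, subtracted and compared,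
   never rounded to naturals, and there is no nonzero real constant. *)
Inductive instr : Type :=
| NConst of nat & nat
| NAdd of nat & nat & nat
| NSub of nat & nat & nat
| NHalf of nat & nat
| NLoad of nat & nat
| NStore of nat & nat
| RAdd of nat & nat & nat
| RSub of nat & nat & nat
| RLoad of nat & nat
| RStore of nat & nat.

Inductive test : Type :=
| NLe of nat & nat
| RLe of nat & nat.

Inductive program : Type :=
| Skip
| Do of instr
| Seq of program & program
| If of test & program & program
| While of test & program.

Record state (R : realType) := State {
  nreg : nat -> nat;
  narr : nat -> nat;
  rreg : nat -> R;
  rarr : nat -> R
}.

Definition update (T : Type) (f : nat -> T) (i : nat) (v : T) : nat -> T :=
  fun j => if j == i then v else f j.

Definition run_instr (R : realType) (a : instr) (s : state R) : state R :=
  let: State n N x X := s in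
  match a with
  | NConst i c => State (update n i c) N x X
  | NAdd i j k => State (update n i (n j + n k)%N) N x X
  | NSub i j k => State (update n i (n j - n k)%N) N x X
  | NHalf i j => State (update n i (n j)./2) N x X
  | NLoad i j => State (update n i (N (n j))) N x X
  | NStore i j => State n (update N (n i) (n j)) x X
  | RAdd i j k => State n N (update x i (x j + x k)) X
  | RSub i j k => State n N (update x i (x j - x k)) X
  | RLoad i j => State n N (update x i (X (n j))) X
  | RStore i j => State n N x (update X (n i) (x j))
  end.

Definition run_test (R : realType) (b : test) (s : state R) : bool :=
  match b with
  | NLe i j => (nreg s i <= nreg s j)%N
  | RLe i j => rreg s i <= rreg s j
  end.

(* [exec p s t s']: from state [s], program [p] halts in state [s'] after
   exactly [t] units of time. *)
Inductive exec (R : realType) : program -> state R -> nat -> state R -> Prop :=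
| exec_skip s : exec Skip s 1 s
| exec_do a s : exec (Do a) s 1 (run_instr a s)
| exec_seq p q s t s' t' s'' :
    exec p s t s' -> exec q s' t' s'' -> exec (Seq p q) s (t + t')%N s''
| exec_if_true b p q s t s' :
    run_test b s -> exec p s t s' -> exec (If b p q) s t.+1 s'
| exec_if_false b p q s t s' :
    ~~ run_test b s -> exec q s t s' -> exec (If b p q) s t.+1 s'
| exec_while_true b p s t s' t' s'' :
    run_test b s -> exec p s t s' -> exec (While b p) s' t' s'' ->
    exec (While b p) s (t + t').+1 s''
| exec_while_false b p s :
    ~~ run_test b s -> exec (While b p) s 1 s.

Definition nth_or (T : Type) (n : nat) (v : T) (f : 'I_n -> T) (i : nat) : T :=
  oapp f v (insub i).

(* With n elements x_0, ..., x_(n-1) (in the order of [enum]) and g colors, the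
   initial state is
     nreg 0 = n, nreg 1 = g, nreg 2 = number of centers allowed,
     narr l = demand of color l  for l < g,
     narr (g + l * n + i) = 1 if x_i has color l, else 0  for l < g, i < n,
     rarr (i * n + j) = distance from x_i to x_j  for i, j < n,
   and everything else is 0. *)
Definition input (R : realType) (I : instance R) : state R :=
  let n := #|points I| in
  let g := ncolors I in
  {| nreg := nth 0%N [:: n; g; ncenters I];
     narr := fun a =>
       if (a < g)%N then nth_or 0%N (@demand R I) a
       else nth_or 0%N
         (fun l : 'I_g =>
            nth_or 0%N (fun i : 'I_n => (enum_val i \in @color R I l) : nat)
              ((a - g) %% n)%N)
         ((a - g) %/ n)%N;
     rreg := fun=> 0;
     rarr := fun a =>
       nth_or 0
         (fun i : 'I_n =>
            nth_or 0 (fun j : 'I_n => mdist (enum_val i) (enum_val j))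
              (a %% n)%N)
         (a %/ n)%N |}.

(* Element x_i belongs to the returned set iff narr i is finally nonzero. *)
Definition output (R : realType) (I : instance R) (s : state R) :
    {set points I} :=
  [set x | narr s (enum_rank x) != 0%N].

(* Main.v *)
Require Import Defs.
From HB Require Import structures.
From mathcomp Require Import all_boot all_order all_algebra.
From mathcomp Require Import reals.
From mathcomp Require Import zify ring lra.

Set Implicit Arguments.
Unset Strict Implicit.
Unset Printing Implicit Defensive.

Import Order.TTheory GRing.Theory Num.Theory.

(* Fix a radius r, one of the pairwise distances, and suppose that some set C of
   at most k centers has radius r.  Points receive prices Y (a fractional set of
   centers, scaled by N); the mass of a point is the price of its r-ball.
   Choosing greedily by decreasing mass gives a set S of centers that are
   pairwise more than 4r apart, such that every point lies within 4r of a member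
   of S of at least the same mass; let B be the union of the r-balls around S,
   which are disjoint.
   - If at most g - 1 members of C lie outside B, where g is the number of
     colors, guess these; every other member of C lies within r of a unique s in
     S, whose 2r-ball covers what it covers, and the 2r-balls around S are
     disjoint, so S can be completed to a solution by dynamic programming.
   - Otherwise at most k - g members of C lie in B.  If B has price at least
     N (k - g + 1), lower the prices in B by one.  If the fractional coverage of
     some colors falls short of the demand by N, raise the prices of the balls
     that cover points of these colors.  These are perceptron steps: every one
     brings Y closer to N times the indicator of C in Euclidean norm, by an
     amount that bounds the number of steps.
   - Otherwise the masses give a fractional choice of clusters (the points of
     mass at most that of a member of S within 4r) which costs less than
     k - g + 1 and misses every demand by less than one.  It can be made sparse,
     with at most g fractional entries, and these are rounded up.
   No test decides between the first and the last case: the algorithm tries all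
   guesses for both and checks every candidate, so that only the existence of a
   successful attempt has to be proved.  The slack of one in all inequalities,
   due to integrality, is what makes approximate linear programming enough. *)

(** * Sparse rounding *)

Section SparseRounding.
Local Open Scope ring_scope.
Variables (T : finType) (g : nat) (a : 'I_g -> T -> rat).

Definition fractional (z : T -> rat) : {set T} := [set s | 0 < z s < 1].

(** With more points in [A] than constraints, the matrix of the [a l s] has a nonzero left kernel
    vector. Its sign is free, so the total can be kept from growing. *)
Lemma kernel_direction (A : {set T}) : (g < #|A|)%N ->
  exists w : T -> rat, [/\ forall s, s \notin A -> w s = 0,
    exists2 s, s \in A & w s != 0, forall l, \sum_s w s * a l s = 0
    & \sum_s w s <= 0].
Proof.
move=> gA; pose M : 'M[rat]_(#|A|, g) := \matrix_(i, l) a l (enum_val i).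
have kM : kermx M != 0.
  by rewrite -mxrank_eq0 mxrank_ker subn_eq0 -ltnNge (leq_ltn_trans (rank_leq_col M)).
pose v := nz_row (kermx M).
have vM : v *m M = 0 by apply/sub_kermxP; exact: nz_row_sub.
have v0 : v != 0 by rewrite nz_row_eq0.
pose w s := \sum_(i < #|A|) (if enum_val i == s then v 0 i else 0).
have wE F : \sum_s w s * F s = \sum_i v 0 i * F (enum_val i).
  under eq_bigr do rewrite mulr_suml.
  rewrite exchange_big /=; apply: eq_bigr => i _.
  rewrite (bigD1 (enum_val i)) //= eqxx big1 ?addr0 // => s.
  by rewrite eq_sym => /negbTE ->; rewrite mul0r.
have wout s : s \notin A -> w s = 0.
  move=> sA; rewrite /w big1 // => i _; case: eqP => // es.
  by move: sA; rewrite -es enum_valP.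
have wval i : w (enum_val i) = v 0 i.
  rewrite /w (bigD1 i) //= eqxx big1 ?addr0 // => j ji.
  by case: eqP => // /enum_val_inj ej; rewrite ej eqxx in ji.
have [i vi] : exists i, v 0 i != 0.
  apply/existsP; apply: contra_neqT v0 => /existsPn h.
  by apply/rowP => i; rewrite mxE; apply/eqP; move: (h i); rewrite negbK.
have wl l : \sum_s w s * a l s = 0.
  transitivity ((v *m M) 0 l); last by rewrite vM mxE.
  by rewrite wE mxE; apply: eq_bigr => j _; rewrite [M _ _]mxE.
have [le0|gt0] := leP (\sum_s w s) 0.
  exists w; split=> //; exists (enum_val i); first exact: enum_valP.
  by rewrite wval.
exists (fun s => - w s); split.
- by move=> s /wout ->; rewrite oppr0.
- by exists (enum_val i); rewrite ?enum_valP // wval oppr_eq0.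
- by move=> l; under eq_bigr do rewrite mulNr; rewrite sumrN wl oppr0.
- by rewrite sumrN oppr_le0 ltW.
Qed.

(** Moving along a kernel direction preserves all constraints; the move stops when the first
    fractional entry becomes 0 or 1. *)
Lemma reduce_fractional (z : T -> rat) :
  (forall s, 0 <= z s <= 1) -> (g < #|fractional z|)%N ->
  exists z' : T -> rat, [/\ forall s, 0 <= z' s <= 1,
    (#|fractional z'| < #|fractional z|)%N,
    forall l, \sum_s z' s * a l s = \sum_s z s * a l s
    & \sum_s z' s <= \sum_s z s].
Proof.
move=> z01 /kernel_direction [w [wout [s1 s1F ws1] wl wle]].
(* The distance along [w] at which coordinate [s] reaches 1, if [w s] is positive, or 0, if it is
   negative; the least one keeps all coordinates in the unit interval. *)
pose step s := if 0 < w s then (1 - z s) / w s else - z s / w s.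
have [s0 ws0 s0min] : exists2 s0, w s0 != 0 & forall s, w s != 0 -> step s0 <= step s.
  by case: (@Order.TotalTheory.arg_minP _ _ _ s1 (fun s => w s != 0) step ws1)
    => s ws smin; exists s.
have s0F : s0 \in fractional z by apply: contraR ws0 => /wout ->.
have wF s : w s != 0 -> 0 < z s < 1.
  by move=> ws; have : s \in fractional z by [apply: contraR ws => /wout ->];
    rewrite inE.
have step_ge0 s : w s != 0 -> 0 <= step s.
  move=> ws; have /andP[z0 z1] := wF s ws; rewrite /step; case: ltP => w0.
    by rewrite divr_ge0 ?subr_ge0 // ltW.
  by rewrite mulNr -mulrN -invrN divr_ge0 ?oppr_ge0 // ltW.
pose t := step s0; pose z' s := z s + t * w s.
have t0 : 0 <= t by exact: step_ge0.
have z'01 s : 0 <= z' s <= 1.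
  rewrite /z'; have [->|ws] := eqVneq (w s) 0; first by rewrite mulr0 addr0.
  have := s0min s ws; rewrite -/t /step.
  have /andP[z0 z1] := wF s ws.
  case: ltP => w0 tle.
    have : t * w s <= 1 - z s by rewrite -ler_pdivlMr.
    have : 0 <= t * w s by rewrite mulr_ge0 // ltW.
    by lra.
  have w0' : w s < 0 by rewrite lt_neqAle ws.
  have : - z s <= t * w s by rewrite -ler_ndivlMr.
  have : t * w s <= 0 by rewrite mulr_ge0_le0.
  by lra.
exists z'; split=> //.
- apply: proper_card; apply/properP; split.
    apply/fintype.subsetP => s; rewrite inE => zs; apply: contraTT isT => sF.
    by move: zs; rewrite /z' (wout s sF) mulr0 addr0; move: sF; rewrite inE =>
      /negbTE ->.
  exists s0 => //; rewrite inE /z' /t /step; case: ifP => _.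
    by rewrite divfK // addrC subrK ltxx andbF.
  by rewrite divfK // subrr ltxx.
- move=> l; transitivity (\sum_s z s * a l s + t * \sum_s w s * a l s);
    last by rewrite wl mulr0 addr0.
  rewrite mulr_sumr -big_split /=.
  by apply: eq_bigr => s _; rewrite /z' mulrDl mulrA.
- by rewrite /z' big_split /= -mulr_sumr gerDl mulr_ge0_le0.
Qed.

(** Fractional entries are removed until at most [g] are left; then all positive entries are rounded
    up, which adds less than one for each fractional entry. *)
Lemma sparse_rounding (z : T -> rat) : (0 < g)%N ->
  (forall l s, 0 <= a l s) -> (forall s, 0 <= z s <= 1) ->
  exists A : {set T}, #|A|%:R < \sum_s z s + g%:R /\
    forall l, \sum_s z s * a l s <= \sum_(s in A) a l s.
Proof.
move=> g0 a0; have [f] := ubnP #|fractional z|.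
elim: f z => // f IHf z; rewrite ltnS => lef z01.
have [gF|Fg] := ltnP g #|fractional z|.
  have [z' [z'01 ltF zl le_z]] := reduce_fractional z01 gF.
  have [A [ltA Al]] := IHf z' (leq_trans ltF lef) z'01.
  exists A; split=> [|l]; last by rewrite -zl.
  by apply: lt_le_trans ltA _; rewrite lerD2r.
exists [set s | 0 < z s]; split; last first.
  move=> l; rewrite big_mkcond /= [leRHS]big_mkcond /=; apply: ler_sum => s _.
  have /andP[z0 z1] := z01 s; rewrite inE; case: ltP => z0'.
    by rewrite -[leRHS]mul1r ler_wpM2r.
  by have -> : z s = 0 by [apply/eqP; rewrite eq_le z0 z0']; rewrite mul0r.
have cardE (A : {set T}) : #|A|%:R = \sum_s (s \in A)%:R :> rat.
  by rewrite -sum1_card natr_sum big_mkcond /=; apply: eq_bigr => s _; case: ifP.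
(* The strict inequality comes from [0 < g] if no entry is fractional, and otherwise from [s0],
   whose rounding adds strictly less than one. *)
have [F0|[s0 s0F]] := set_0Vmem (fractional z).
  apply: (@le_lt_trans _ _ (\sum_s z s)); last by rewrite ltrDl ltr0n.
  rewrite cardE; apply: ler_sum => s _; rewrite inE; have /andP[z0 z1] := z01 s.
  case: ltP => //= z0'; have : s \notin fractional z by rewrite F0 inE.
  by rewrite inE z0' /= -leNgt.
apply: (@lt_le_trans _ _ (\sum_s z s + #|fractional z|%:R)); last first.
  by rewrite lerD2l ler_nat.
have ptw s : (s \in [set s | 0 < z s])%:R <= z s + (s \in fractional z)%:R.
  rewrite !inE; have /andP[z0 z1] := z01 s.
  by case: ltP => /= z0'; case: ltP => /= z1'; lra.
rewrite !cardE -big_split /= (bigD1 s0) //= [ltRHS](bigD1 s0) //=.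
apply: ltr_leD; last by apply: ler_sum => s _; exact: ptw.
by move: s0F; rewrite !inE => h; rewrite h; case/andP: h => h1 h2; rewrite h1 /=; lra.
Qed.

End SparseRounding.

(** * Greedy clustering *)

Lemma sum_card_disjoint (T : finType) (W : T -> {set T}) (A : {set T}) :
  (forall s s' u, u \in W s -> u \in W s' -> s = s') ->
  \sum_(s in A) #|W s| <= #|T|.
Proof.
move=> Wdisj; under eq_bigr do rewrite -sum1_card big_mkcond.
rewrite exchange_big /= -sum1_card; apply: leq_sum => u _.
case: (pickP (fun s => u \in W s)) => [s us|no]; last first.
  by rewrite big1 // => s _; rewrite no.
rewrite -big_mkcondr; apply: (@leq_trans (\sum_(s' | s' == s) 1)); last by
  rewrite big_pred1_eq.
rewrite big_mkcond [leqRHS]big_mkcond; apply: leq_sum => s' _.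
by case: ifP => // /andP[_ us']; rewrite (Wdisj _ _ _ us' us) eqxx.
Qed.

Section Clustering.
Variables (n g : nat) (b1 b2 b4 : rel 'I_n).
Variables (col : 'I_g -> {set 'I_n}) (dem : 'I_g -> nat) (k N : nat).
Hypothesis b1C : symmetric b1.
Hypothesis b2C : symmetric b2.
Hypothesis b4C : symmetric b4.
Hypothesis b1_refl : reflexive b1.
Hypothesis b1W : subrel b1 b2.
Hypothesis b2W : subrel b2 b4.
Hypothesis b1T : forall u v w, b1 u v -> b1 v w -> b2 u w.
Hypothesis b2T : forall u v w, b2 u v -> b2 v w -> b4 u w.

(** The relations [b1], [b2], [b4] stand for distance at most r, 2r, 4r; coverage is measured at the
    radius 4r of the guarantee. *)
Definition valid (C : {set 'I_n}) : bool :=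
  (#|C| <= k) &&
  [forall l, dem l <= #|[set u in col l | [exists c, (c \in C) && b4 c u]]|].

Definition ball1 (C : {set 'I_n}) : {set 'I_n} :=
  [set u | [exists c, (c \in C) && b1 c u]].

(** The common form of both kinds of candidates: guessed centers [G] and cluster centers [A].
    Removing [ball1 G] from disjoint clusters makes the counts additive, so no point is counted
    twice. *)
Lemma valid_union (W : 'I_n -> {set 'I_n}) (G A : {set 'I_n}) :
  (forall s u, u \in W s -> b4 s u) ->
  (forall s s' u, u \in W s -> u \in W s' -> s = s') ->
  #|G| + #|A| <= k ->
  (forall l, dem l <= #|ball1 G :&: col l| +
     \sum_(s in A) #|(W s :\: ball1 G) :&: col l|) ->
  valid (G :|: A).
Proof.
move=> Wb4 Wdisj GA cov; apply/andP; split.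
  by apply: leq_trans GA; rewrite cardsU leq_subr.
apply/forallP => l; apply: leq_trans (cov l) _.
pose V s := (W s :\: ball1 G) :&: col l.
have -> : \sum_(s in A) #|V s| = #|\bigcup_(s in A) V s|.
  have Vdisj s s' : s != s' -> [disjoint V s & V s'].
    move=> ss'; apply/pred0P => u /=; apply: contraNF ss'.
    by rewrite !inE => /andP[/andP[/andP[_ us] _] /andP[/andP[_ us'] _]];
      apply/eqP; exact: Wdisj us us'.
  have [e eA] : exists e, #|A| = e by exists #|A|.
  elim: e (A) eA => [|e IHe] B.
    by move/cards0_eq ->; rewrite !big_set0 cards0.
  move=> eB; have /card_gt0P[s sB] : 0 < #|B| by rewrite eB.
  rewrite (big_setD1 s) //= (big_setD1 s sB) /= cardsU.
  rewrite (_ : _ :&: \bigcup_(i in _) _ = set0) ?cards0 ?subn0 ?IHe //.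
    by move: eB; rewrite (cardsD1 s) sB => -[].
  apply/setP => u; rewrite inE [RHS]inE; apply/negbTE/negP => /andP[us /bigcupP[s']].
  rewrite in_setD1 => /andP[ss' _] us'; have := Vdisj _ _ ss'.
  by move/pred0P/(_ u); rewrite /= us us'.
have dis : (ball1 G :&: col l) :&: \bigcup_(s in A) V s = set0.
  apply/setP => u; rewrite inE [RHS]inE; apply/negbTE/negP.
  case/andP => /setIP[uG _] /bigcupP[s _].
  by rewrite inE => /andP[/setDP[_ /negP]].
have := cardsU (ball1 G :&: col l) (\bigcup_(s in A) V s).
rewrite dis cards0 subn0 => <-; apply: subset_leq_card; apply/fintype.subsetP => u.
rewrite in_setU !inE => /orP[/andP[/existsP[c /andP[cG cu]] ->]|/bigcupP[s sA]].
  by apply/existsP; exists c; rewrite inE cG /= b2W ?b1W.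
rewrite !inE => /andP[/andP[_ us] ->]; apply/existsP; exists s.
by rewrite inE sA orbT /= Wb4.
Qed.

Section Prices.
Variable Y : 'I_n -> nat.

Definition mass (u : 'I_n) : nat := \sum_(v | b1 u v) Y v.

Definition better (u v : 'I_n) : bool :=
  (mass v < mass u) || (mass u == mass v) && (u < v).

(** The number of better points is a rank; it tells after how many rounds of the selection loop the
    choice at a point is final. *)
Lemma better_lt_rank u v : better u v ->
  #|[set w | better w u]| < #|[set w | better w v]|.
Proof.
move=> uv; apply: proper_card; apply/properP; split.
  by apply/fintype.subsetP => w; rewrite !inE; move: uv; rewrite /better; lia.
by exists u; rewrite inE // /better; lia.
Qed.

Lemma rank_lt u : #|[set w | better w u]| < n.
Proof.
rewrite -[ltnRHS](card_ord n) -cardsT; apply: proper_card; apply/properP.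
by split; [exact: subsetT | exists u; rewrite ?inE // /better; lia].
Qed.

(** The greedy choice is described by a fixed-point equation: a point is taken unless a better taken
    point lies within 4r. *)
Variable Sel : pred 'I_n.
Hypothesis SelE : forall u, Sel u = ~~ [exists v, [&& better v u, b4 v u & Sel v]].

Lemma better_total u v : u != v -> better u v || better v u.
Proof. by rewrite /better -val_eqE /=; lia. Qed.

Lemma betterP u v : better u v -> mass v <= mass u.
Proof. by rewrite /better; lia. Qed.

(** Of two distinct selected points one is better and would have excluded the other. *)
Lemma sel_far s s' : Sel s -> Sel s' -> b4 s s' -> s = s'.
Proof.
move=> hs hs' ss'; apply/eqP/negPn/negP => /better_total /orP[] h.
  move: hs'; rewrite SelE => /existsPn /(_ s); by rewrite h ss' hs.
by move: hs; rewrite SelE => /existsPn /(_ s'); rewrite h b4C ss' hs'.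
Qed.

Lemma sel_disjoint s s' u : Sel s -> Sel s' -> b2 s u -> b2 s' u -> s = s'.
Proof. by move=> hs hs' su s'u; apply: sel_far => //; apply: b2T su _; rewrite b2C. Qed.

Definition claims s u : bool := [&& Sel s, b4 s u & mass u <= mass s].

(** Several selected points may claim [u]; the least index decides, so that the clusters partition
    the points. *)
Definition owns s u : bool :=
  claims s u && ~~ [exists s' : 'I_n, (s' < s) && claims s' u].

Lemma owns_uniq s s' u : owns s u -> owns s' u -> s = s'.
Proof.
move=> /andP[c /existsPn f] /andP[c' /existsPn f']; apply/val_inj/eqP.
move: (f s') (f' s); rewrite c c' /= !andbT; lia.
Qed.

Lemma b4_refl : reflexive b4. Proof. by move=> u; rewrite b2W ?b1W. Qed.

(** A selected point claims itself; any other point was excluded by a better selected point within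
    4r, which claims it. *)
Lemma owns_ex u : exists s, owns s u.
Proof.
have [s cs] : exists s, claims s u.
  case su : (Sel u); first by exists u; rewrite /claims su b4_refl /=.
  move/negbT: su; rewrite SelE negbK => /existsP[v /and3P[vu b sv]].
  by exists v; rewrite /claims sv b betterP.
pose s0 := [arg min_(s' < s | claims s' u) (s' : nat)].
exists s0; rewrite /owns /s0; case: arg_minnP => //= s' -> smin /=.
by apply/existsPn => s''; apply/negP => /andP[lt /smin]; rewrite leqNgt lt.
Qed.

(** The set B of the outline. *)
Definition core : {set 'I_n} := [set v | [exists s, Sel s && b1 s v]].

Lemma sum_sel_mass (F : 'I_n -> nat) :
  \sum_(s | Sel s) \sum_(v | b1 s v) F v = \sum_(v in core) F v.
Proof.
rewrite (exchange_big_dep (mem core)) /=; last first.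
  by move=> s v hs sv; rewrite inE; apply/existsP; exists s; rewrite hs.
apply: eq_bigr => v; rewrite inE => /existsP[s /andP[hs sv]].
rewrite (big_pred1 s) // => s' /=; apply/andP/eqP => [[hs' s'v]|-> //].
by apply: sel_disjoint (b1W s'v) (b1W sv).
Qed.

(** The last case of the outline. The choice [z] gives a selected point its mass, capped at [N],
    over [N]. It costs less than [k + 1 - g] because the r-balls are disjoint, and every point
    receives at least its own capped mass, since its owner has no smaller mass. Sparse rounding then
    adds less than [g] to the cost. *)
Lemma rounding_success : 0 < g -> 0 < N ->
  \sum_(v in core) Y v < N * (k + 1 - g) ->
  (forall l, N * dem l < \sum_(u in col l) minn N (mass u) + N) ->
  exists A : {set 'I_n}, #|A| <= k /\
    forall l, dem l <= \sum_(s in A) #|[set u | owns s u] :&: col l|.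
Proof.
move=> g_gt0 N0 ltY cov.
have NQ : (0 < N%:R :> rat)%R by rewrite ltr0n.
pose z s : rat := if Sel s then ((minn N (mass s))%:R / N%:R)%R else 0%R.
pose a l s : rat := (#|[set u | owns s u] :&: col l|%:R)%R.
have [||A [ltA Al]] := @sparse_rounding _ g a z g_gt0.
- by move=> l s; rewrite ler0n.
- move=> s; rewrite /z; case: ifP => // _.
  by rewrite divr_ge0 ?ler0n //= ler_pdivrMr // mul1r ler_nat geq_minl.
exists A; split.
  have : (\sum_s z s < (k + 1 - g)%:R)%R.
    apply: (@le_lt_trans _ _ ((\sum_(v in core) Y v)%:R / N%:R)%R); last first.
      by rewrite ltr_pdivrMr // -natrM ltr_nat mulnC.
    rewrite -sum_sel_mass natr_sum mulr_suml [leRHS]big_mkcond /=.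
    apply: ler_sum => s _; rewrite /z; case: ifP => // _.
    by rewrite ler_pM2r ?invr_gt0 // ler_nat geq_minr.
  move=> ltz; have : (#|A|%:R < (k.+1)%:R :> rat)%R; last by rewrite ltr_nat.
  apply: lt_trans ltA _; rewrite -[ltRHS](_ : (k + 1 - g)%:R + g%:R = _)%R.
    by rewrite ltrD2r.
  (* If [k + 1 < g], the truncated difference is 0 and [ltY] is contradictory. *)
  rewrite -natrD; congr (_%:R)%R; move: ltY; case: (leqP g (k + 1)) => [|h]; first lia.
  by rewrite (_ : k + 1 - g = 0) ?muln0; lia.
move=> l; have := Al l; rewrite /a -natr_sum; set X := \sum_(s in A) _ => leX.
(* Integrality: an integer [X] with [N * dem l < N * X + N] is at least [dem l]. *)
suff : ((N * dem l)%:R < (N * X + N)%:R :> rat)%R by rewrite ltr_nat; nia.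
apply: (@lt_le_trans _ _ ((\sum_(u in col l) minn N (mass u) + N)%:R)%R).
  by rewrite ltr_nat.
rewrite !natrD lerD2r natrM; apply: le_trans (ler_wpM2l (ltW NQ) leX).
rewrite natr_sum mulr_sumr.
(* The coverage is regrouped by points, each of which has exactly one owner. *)
have -> : (\sum_s N%:R * (z s * #|[set u | owns s u] :&: col l|%:R) =
  \sum_(u in col l) \sum_(s | owns s u) N%:R * z s)%R.
  rewrite (exchange_big_dep predT) //=; apply: eq_bigr => s _.
  rewrite mulrA sumr_const -[RHS]mulr_natr; congr (_ * _%:R)%R.
  by apply: eq_card => u; rewrite !inE andbC.
apply: ler_sum => u ul; have [s os] := owns_ex u.
rewrite (big_pred1 s) => [|s']; last first.
  by apply/idP/eqP => [os'|->//]; exact: owns_uniq os' os.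
have /andP[/and3P[hs _ le_m] _] := os.
rewrite /z hs mulrC divfK ?gt_eqF // ler_nat; lia.
Qed.

(** The first case of the outline: [G] is the part of [C] outside [core], and each remaining member
    of [C] is replaced by the selected point within r of it, whose 2r-ball contains its r-ball. *)
Lemma guess_success (C : {set 'I_n}) : #|C| <= k ->
  (forall l, dem l <= #|ball1 C :&: col l|) ->
  k < #|C :&: core| + g ->
  exists G A : {set 'I_n}, [/\ #|G| <= g, #|G| + #|A| <= k &
    forall l, dem l <= #|ball1 G :&: col l| +
      \sum_(s in A) #|([set u | Sel s && b2 s u] :\: ball1 G) :&: col l|].
Proof.
move=> Ck cov ltk; pose G := C :\: core.
pose A := [set s | Sel s && [exists c, (c \in C) && b1 s c]].
have CE := cardsID core C.
exists G, A; split.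
- by rewrite /G; lia.
- have : #|A| <= #|C :&: core|.
    (* The selected point within r of [c] is unique, so [f] maps [C :&: core] onto a set containing
       [A]. *)
    pose f c := odflt c [pick s | Sel s && b1 s c].
    apply: leq_trans (leq_imset_card f _); apply: subset_leq_card.
    apply/fintype.subsetP => s; rewrite inE => /andP[hs /existsP[c /andP[cC sc]]].
    apply/imsetP; exists c.
      by rewrite !inE cC; apply/existsP; exists s; rewrite hs.
    rewrite /f; case: pickP => [s' /andP[hs' s'c]|/(_ s)]; last by rewrite hs sc.
    by rewrite /= (sel_disjoint hs hs' (b1W sc) (b1W s'c)).
  by move=> leA; apply: leq_trans Ck; rewrite -CE addnC leq_add2r.
move=> l; apply: leq_trans (cov l) _.
pose V s := ([set u | Sel s && b2 s u] :\: ball1 G) :&: col l.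
apply: (@leq_trans #|(ball1 G :&: col l) :|: \bigcup_(s in A) V s|).
  apply: subset_leq_card; apply/fintype.subsetP => u /setIP[]; rewrite inE.
  case/existsP=> c /andP[cC cu] ul.
  rewrite in_setU in_setI ul andbT; case: (boolP (u \in ball1 G)) => //= uG.
  have : c \in core.
    apply: contraR uG => cS; rewrite inE; apply/existsP; exists c.
    by rewrite cu in_setD cS cC.
  rewrite inE => /existsP[s /andP[hs sc]].
  apply/bigcupP; exists s.
    by rewrite inE hs; apply/existsP; exists c; rewrite cC.
  by rewrite in_setI in_setD uG ul inE hs (b1T sc cu).
rewrite cardsU; apply: leq_trans (leq_subr _ _) _; rewrite leq_add2l.
elim/big_rec2: _ => [|s B X _ IH]; first by rewrite cards0.
by rewrite cardsU; apply: leq_trans (leq_subr _ _) _; rewrite leq_add2l.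
Qed.

End Prices.
End Clustering.

(** * The potential of the prices *)

Section Potential.
Variables (n g : nat) (b1 : rel 'I_n).
Variables (col : 'I_g -> {set 'I_n}) (dem : 'I_g -> nat) (k N : nat).
Variables (C : {set 'I_n}) (Y : 'I_n -> nat).
Hypothesis b1C : symmetric b1.

(** The squared Euclidean distance from the prices to [N] times the indicator of [C]. *)
Definition potential (Z : 'I_n -> nat) : int :=
  (\sum_v ((Z v)%:Z - (N * (v \in C))%:Z) ^+ 2)%R.

(** On [S] the prices exceed [N] times the indicator of [C] by at least
    [N * (k + 1 - g) - N * (k - g) = N] in total. Lowering them by one thus takes at least [2 * N]
    off the squared distance and adds at most [n <= N]. *)
Lemma potential_cut (S : {set 'I_n}) :
  n <= N -> #|C :&: S| + g <= k -> N * (k + 1 - g) <= \sum_(v in S) Y v ->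
  (potential (fun v => Y v - (v \in S))%N <= potential Y - N%:Z)%R.
Proof.
move=> nN CS leY; rewrite /potential.
pose G v := ((v \in S)%:Z * ((Y v)%:Z - (N * (v \in C))%:Z))%R.
have EG : (N%:Z <= \sum_v G v)%R.
  have -> : (\sum_v G v = (\sum_(v in S) Y v)%:Z - (N * #|C :&: S|)%:Z)%R.
    rewrite -sum1_card big_distrr /=.
    rewrite (big_mkcond (mem S)) (big_mkcond (mem (C :&: S))) /=.
    rewrite !(big_morph Posz PoszD (erefl _)) -sumrB; apply: eq_bigr => v _.
    by rewrite /G inE; case: (v \in S); case: (v \in C) => /=; lia.
  nia.
have : (\sum_v ((Y v - (v \in S))%:Z - (N * (v \in C))%:Z) ^+ 2 <=
  \sum_v ((((Y v)%:Z - (N * (v \in C))%:Z) ^+ 2 - 2 * G v) + 1))%R.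
  apply: ler_sum => v _; rewrite /G; case: (v \in S) => /=; last by rewrite
    subn0 mul0r mulr0 subr0 lerDl.
  (* A price 0 stays 0 by truncated subtraction; the bound holds there too, since [G v] is then not
     positive. *)
  by case: (Y v) => [|y]; nia.
rewrite big_split /= sumrB -mulr_sumr sumr_const card_ord => h.
apply: le_trans h _; rewrite !natz; set X1 := bigop _ _ _; set X2 := bigop _ _
  _ in EG *; lia.
Qed.

(** For [m] the masses, this is a supergradient in the prices of the concave sum of all masses
    capped at [N], taken over the colors in [viol]. *)
Definition raise (viol : pred 'I_g) (m : 'I_n -> nat) (v : 'I_n) : nat :=
  \sum_(l | viol l) \sum_(u in col l | m u < N) b1 u v.

(** The supergradient inequality: the capped masses of color [l] sum to at least [N * dem l] at [N]
    times the indicator of [C], but to at most [N * dem l - N] at [Y]. *)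
Lemma raise_gap l :
  dem l <= #|ball1 b1 C :&: col l| ->
  \sum_(u in col l) minn N (mass b1 Y u) + N <= N * dem l ->
  \sum_v (\sum_(u in col l | mass b1 Y u < N) b1 u v) * Y v + N <=
  \sum_v (\sum_(u in col l | mass b1 Y u < N) b1 u v) * (N * (v \in C)).
Proof.
move=> cov viol.
have swap F : \sum_v (\sum_(u in col l | mass b1 Y u < N) b1 u v) * F v =
    \sum_(u in col l | mass b1 Y u < N) \sum_(v | b1 u v) F v.
  under eq_bigr do rewrite big_distrl /=.
  rewrite exchange_big /=; apply: eq_bigr => u _.
  by rewrite [RHS]big_mkcond /=; apply: eq_bigr => v _; case: (b1 u v); rewrite ?mul1n.
rewrite !swap.
(* This holds point by point: a point covered by [C] brings [N] either from its cap, if its mass is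
   at least [N], or from a member of [C] near it. *)
suff : N * #|ball1 b1 C :&: col l| +
  \sum_(u in col l | mass b1 Y u < N) mass b1 Y u <=
  \sum_(u in col l | mass b1 Y u < N) \sum_(v | b1 u v) N * (v \in C) +
  \sum_(u in col l) minn N (mass b1 Y u).
  move=> h; have h' : N * dem l <= N * #|ball1 b1 C :&: col l| by rewrite
    leq_mul2l cov orbT.
  rewrite -[X in X + N <= _]/(\sum_(u in col l | mass b1 Y u < N) mass b1 Y u).
  move: h h' viol; set S1 := bigop _ _ _; set S2 := bigop _ _ _; set S3 :=
    bigop _ _ _; lia.
rewrite -sum1_card big_distrr /=.
rewrite (eq_bigl (fun u => (u \in col l) && (u \in ball1 b1 C))); last first.
  by move=> u; rewrite inE andbC.
rewrite !big_mkcondr /= -!big_split /=; apply: leq_sum => u _.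
have hit : u \in ball1 b1 C -> N <= \sum_(v | b1 u v) N * (v \in C).
  rewrite inE => /existsP[c /andP[cC cu]].
  by rewrite (bigD1 c) ?[b1 u c]b1C //= cC muln1 leq_addr.
case: ltnP => uN; case: ifP => [/hit|_]; rewrite ?muln1 ?addn0 ?add0n
  ?leq_add2r ?leq_addl //.
Qed.

(** With [q] violated colors the linear term gains [2 * N * q]. No price grows by more than [q * n],
    so the quadratic term costs at most [n ^ 3 * q * q <= N * q]. *)
Lemma potential_raise (viol : pred 'I_g) : n ^ 3 * g <= N ->
  (exists l, viol l) ->
  (forall l, dem l <= #|ball1 b1 C :&: col l|) ->
  (forall l, viol l ->
     \sum_(u in col l) minn N (mass b1 Y u) + N <= N * dem l) ->
  (potential (fun v => Y v + raise viol (mass b1 Y) v)%N <= potential Y - N%:Z)%R.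
Proof.
move=> nN [l0 viol0] cov violE; pose q := \sum_(l | viol l) 1.
have q0 : 0 < q by rewrite /q (bigD1 l0).
have qg : q <= g by rewrite /q sum1_card; apply: leq_trans (max_card _) _;
  rewrite card_ord.
set A := raise viol (mass b1 Y).
have leA v : A v <= q * n.
  rewrite /A /raise /q big_distrl /=; apply: leq_sum => l _; rewrite mul1n.
  apply: (@leq_trans (\sum_(u < n) 1)); last by rewrite sum1_card card_ord.
  by rewrite big_mkcond /=; apply: leq_sum => u _; case: ifP => // _; case: (b1 u v).
have gap : \sum_v A v * Y v + N * q <= \sum_v A v * (N * (v \in C)).
  have dist F : \sum_v A v * F v =
     \sum_(l | viol l) \sum_v (\sum_(u in col l | mass b1 Y u < N) b1 u v) * F v.
    rewrite exchange_big /=; apply: eq_bigr => v _.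
    by rewrite /A /raise big_distrl.
  rewrite !dist /q big_distrr /= -big_split /=; apply: leq_sum => l lv.
  by rewrite muln1; apply: raise_gap => //; exact: violE.
have sqA : \sum_v A v * A v <= n * (q * n * (q * n)).
  apply: (@leq_trans (\sum_(v < n) q * n * (q * n))); last by rewrite
    sum_nat_const card_ord.
  by apply: leq_sum => v _; apply: leq_mul.
rewrite /potential.
have -> : (\sum_v ((Y v + A v)%N%:Z - (N * (v \in C))%:Z) ^+ 2 =
  \sum_v ((Y v)%:Z - (N * (v \in C))%:Z) ^+ 2 +
  (2 * ((\sum_v A v * Y v)%N%:Z - (\sum_v A v * (N * (v \in C)))%N%:Z) +
  (\sum_v A v * A v)%N%:Z))%R.
  rewrite !(big_morph Posz PoszD (erefl _)) -sumrB mulr_sumr -!big_split /=.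
  by apply: eq_bigr => v _; rewrite !PoszD !PoszM; ring.
have : n * (q * n * (q * n)) <= N * q.
  have -> : n * (q * n * (q * n)) = (n ^ 3 * q) * q by ring.
  rewrite leq_mul2r; apply/orP; right; apply: leq_trans nN.
  by rewrite leq_mul2l qg orbT.
nia.
Qed.

Lemma potential_ge0 Z : (0 <= potential Z)%R.
Proof. by apply: sumr_ge0 => v _; exact: sqr_ge0. Qed.

Lemma potential0 : (potential (fun=> 0%N) <= (N * N * n)%:Z)%R.
Proof.
rewrite /potential; apply: (@le_trans _ _ (\sum_(v < n) (N * N)%:Z)%R).
  by apply: ler_sum => v _; case: (v \in C); rewrite ?muln1 ?muln0; nia.
by rewrite sumr_const card_ord; lia.
Qed.

End Potential.

(** * Positional encoding *)

(** The most significant digit comes first; the leading [a] may exceed the base. *)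
Fixpoint digits_value (b a : nat) (f : nat -> nat) (l : nat) : nat :=
  if l is l'.+1 then digits_value b a f l' * b + f l' else a.

(** The value is linear in the digits, whatever their size; only reading the digits back requires
    them to be below the base. *)
Lemma digits_value_sum b l (T : finType) (A : {set T}) (a : T -> nat) (f : T ->
  nat -> nat) :
  \sum_(s in A) digits_value b (a s) (f s) l =
  digits_value b (\sum_(s in A) a s) (fun i => \sum_(s in A) f s i) l.
Proof.
by elim: l => //= l <-; rewrite big_split big_distrl.
Qed.

Lemma digits_value_inj b l a a' f f' :
  (forall i, i < l -> f i < b) -> (forall i, i < l -> f' i < b) ->
  digits_value b a f l = digits_value b a' f' l ->
  a = a' /\ forall i, i < l -> f i = f' i.
Proof.
elim: l => [|l IHl] //= hf hf' e.
have [hl hl'] := (hf l (leqnn _), hf' l (leqnn _)).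
have [|||-> ff] := IHl.
- by move=> i il; apply: hf; exact: leqW.
- by move=> i il; apply: hf'; exact: leqW.
- by have := congr1 (divn^~ b) e; rewrite !divnMDl ?divn_small ?addn0 //; lia.
split=> // i; rewrite ltnS leq_eqVlt => /predU1P[->|/ff //].
by have := congr1 (modn^~ b) e; rewrite !modnMDl !modn_small.
Qed.

Lemma digits_value_lt b l a f :
  (forall i, i < l -> f i < b) -> digits_value b a f l < a.+1 * b ^ l.
Proof.
elim: l => [|l IHl] /= hf; first by rewrite expn0 muln1.
have := IHl (fun i il => hf i (leqW il)); have := hf l (leqnn _).
by rewrite expnSr mulnA; set X := _ * b ^ l; nia.
Qed.

(** Here the least significant digit comes first, in the order in which a guess is decoded. *)
Lemma digits_exist b (s : seq nat) : all (fun i => i < b) s ->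
  exists2 q, q < b ^ size s &
    forall j, j < size s -> q %/ b ^ j %% b = nth 0 s j.
Proof.
elim: s => [|i s IHs] /=; first by exists 0.
case/andP=> ib /IHs[q qb qs]; exists (q * b + i).
  by rewrite expnSr; have := leq_mul qb (leqnn b); rewrite mulSn; lia.
case=> [|j] js /=; first by rewrite expn0 divn1 modnMDl modn_small.
have b0 : 0 < b by lia.
by rewrite expnS divnMA divnMDl // (divn_small ib) addn0 qs.
Qed.

(** * A language of bounded loops and its compiler *)

Inductive array :=
  Tmp | Price | Mass | Sel | Guess | Code | Weight | Reach | Wit | Cand | Ok
| Out | Best | Found.

Definition array_id (a : array) : nat :=
  match a with
  | Tmp => 0 | Price => 1 | Mass => 2 | Sel => 3 | Guess => 4 | Code => 5
  | Weight => 6 | Reach => 7 | Wit => 8 | Cand => 9 | Ok => 10 | Out => 11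
  | Best => 12 | Found => 13
  end.

(** The arrays are interleaved with stride 16, a power of two, so that four doublings turn an index
    into an offset. *)
Lemma array_id_lt a : array_id a < 16. Proof. by case: a. Qed.

Lemma array_id_inj : injective array_id. Proof. by case=> -[]. Qed.

Definition memory := array -> nat -> nat.

(** Loops have no other bounds than these, so a bound on the three numbers bounds the running time
    by structural induction. *)
Inductive bound := Points | Colors | Codes.

Inductive expr :=
| EVar of nat
| ECst of nat
| EBudget
| EBound of bound
| EAdd of expr & expr
| ESub of expr & expr
| ELoad of array & expr
| EIn of expr
| EIf of expr & expr & expr & expr
| ECmp of nat & expr & expr
| ESum of nat & bound & expr.

Inductive cmd :=
| CStore of array & expr & expr
| CSeq of cmd & cmd
| CFor of nat & bound & cmd.

(* [dle P c a b] says that the distance stored at address [b] is at most [2 ^ c]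
   times the one stored at address [a]. *)
Record params := Params {
  npts : nat;
  ncol : nat;
  budget : nat;
  ncode : nat;
  inp : nat -> nat;
  dle : nat -> nat -> nat -> bool
}.

Definition bval (P : params) (b : bound) : nat :=
  match b with Points => npts P | Colors => ncol P | Codes => ncode P end.

(** [EIn] gives 0 from [ncode P] on because the cells there hold the arrays instead of the input. *)
Fixpoint eval (P : params) (x : nat -> nat) (m : memory) (e : expr) : nat :=
  match e with
  | EVar v => x v
  | ECst c => c
  | EBudget => budget P
  | EBound b => bval P b
  | EAdd e1 e2 => eval P x m e1 + eval P x m e2
  | ESub e1 e2 => eval P x m e1 - eval P x m e2
  | ELoad a e1 => m a (eval P x m e1)
  | EIn e1 => let i := eval P x m e1 in if ncode P <= i then 0 else inp P i
  | EIf e1 e2 e3 e4 =>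
      if eval P x m e1 <= eval P x m e2 then eval P x m e3 else eval P x m e4
  | ECmp c e1 e2 => dle P c (eval P x m e1) (eval P x m e2)
  | ESum v b e1 => \sum_(i < bval P b) eval P (update x v i) m e1
  end.

Definition mem_set (m : memory) (a : array) (f : nat -> nat) : memory :=
  fun a' => if array_id a' == array_id a then f else m a'.

Fixpoint run (P : params) (x : nat -> nat) (c : cmd) (m : memory) : memory :=
  match c with
  | CStore a e1 e2 =>
      mem_set m a (update (m a) (eval P x m e1) (eval P x m e2))
  | CSeq c1 c2 => run P x c2 (run P x c1 m)
  | CFor v b c1 => iteri (bval P b) (fun i => run P (update x v i) c1) m
  end.

(* Temporaries live in odd registers and variables in even ones.  The registers
   below 6 hold the parameters and the constants 1 and 0; cell [i] of the array
   [a] has address [ncode P + 16 * i + array_id a], above the input. *)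
Definition vreg (v : nat) : nat := v.*2 + 6.
Definition treg (t : nat) : nat := t.*2 + 7.
Definition breg (b : bound) : nat :=
  match b with Points => 0 | Colors => 1 | Codes => 3 end.

Definition straight (l : seq instr) : program :=
  foldr (fun a p => Seq (Do a) p) Skip l.

Definition address (a : array) (t : nat) : seq instr :=
  nseq 4 (NAdd (treg t) (treg t) (treg t)) ++
  [:: NAdd (treg t) (treg t) 3; NConst (treg t.+1) (array_id a);
      NAdd (treg t) (treg t) (treg t.+1)].

(** The old value of the variable is saved in [treg t] and restored at the end, in agreement with
    the local scope of variables in [eval] and [run]. The counter [treg t.+1] is one ahead of the
    variable, as tests are not strict. *)
Definition loop (v : nat) (b : bound) (t : nat) (p : program) : program :=
  Seq (straight [:: NAdd (treg t) (vreg v) 5; NConst (vreg v) 0;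
                    NConst (treg t.+1) 1])
  (Seq (While (NLe (treg t.+1) (breg b))
          (Seq p (straight [:: NAdd (vreg v) (vreg v) 4;
                               NAdd (treg t.+1) (treg t.+1) 4])))
       (Do (NAdd (vreg v) (treg t) 5))).

(** The result goes to [treg t], and only temporaries from [t] on are changed, as on a stack. *)
Fixpoint comp (t : nat) (e : expr) : program :=
  match e with
  | EVar v => Do (NAdd (treg t) (vreg v) 5)
  | ECst c => Do (NConst (treg t) c)
  | EBudget => Do (NAdd (treg t) 2 5)
  | EBound b => Do (NAdd (treg t) (breg b) 5)
  | EAdd e1 e2 =>
      Seq (comp t e1)
        (Seq (comp t.+1 e2) (Do (NAdd (treg t) (treg t) (treg t.+1))))
  | ESub e1 e2 =>
      Seq (comp t e1)
        (Seq (comp t.+1 e2) (Do (NSub (treg t) (treg t) (treg t.+1))))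
  | ELoad a e1 =>
      Seq (comp t e1) (straight (rcons (address a t) (NLoad (treg t) (treg t))))
  | EIn e1 =>
      Seq (comp t e1)
        (If (NLe 3 (treg t)) (Do (NConst (treg t) 0))
                             (Do (NLoad (treg t) (treg t))))
  | EIf e1 e2 e3 e4 =>
      Seq (comp t e1)
        (Seq (comp t.+1 e2)
             (If (NLe (treg t) (treg t.+1)) (comp t e3) (comp t e4)))
  | ECmp c e1 e2 =>
      Seq (comp t e1)
        (Seq (comp t.+1 e2)
           (Seq (straight [:: RLoad 0 (treg t), RLoad 1 (treg t.+1)
                            & nseq c (RAdd 0 0 0)])
                (If (RLe 1 0) (Do (NConst (treg t) 1))
                              (Do (NConst (treg t) 0)))))
  | ESum v b e1 =>
      Seq (Do (NConst (treg t) 0))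
        (loop v b t.+1
           (Seq (comp t.+3 e1) (Do (NAdd (treg t) (treg t) (treg t.+3)))))
  end.

Fixpoint ccomp (t : nat) (c : cmd) : program :=
  match c with
  | CStore a e1 e2 =>
      Seq (comp t e1)
        (Seq (comp t.+1 e2)
           (straight [:: NAdd (treg t.+2) (treg t.+1) 5
                       & rcons (address a t) (NStore (treg t) (treg t.+2))]))
  | CSeq c1 c2 => Seq (ccomp t c1) (ccomp t c2)
  | CFor v b c1 => loop v b t (ccomp t.+2 c1)
  end.

Fixpoint ecost (M : nat) (e : expr) : nat :=
  match e with
  | EVar _ | ECst _ | EBudget | EBound _ => 1
  | EAdd e1 e2 | ESub e1 e2 => ecost M e1 + ecost M e2 + 1
  | ELoad _ e1 => ecost M e1 + 9
  | EIn e1 => ecost M e1 + 2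
  | EIf e1 e2 e3 e4 => ecost M e1 + ecost M e2 + ecost M e3 + ecost M e4 + 1
  | ECmp c e1 e2 => ecost M e1 + ecost M e2 + c + 5
  | ESum _ _ e1 => M * (ecost M e1 + 5) + 7
  end.

Fixpoint ccost (M : nat) (c : cmd) : nat :=
  match c with
  | CStore _ e1 e2 => ecost M e1 + ecost M e2 + 10
  | CSeq c1 c2 => ccost M c1 + ccost M c2
  | CFor _ _ c1 => M * (ccost M c1 + 4) + 6
  end.

(** * Correctness and cost of compiled programs *)

Section Compiler.
Variables (R : realType) (d : nat -> R).
Implicit Types (s : state R) (P : params) (x : nat -> nat) (m : memory).

Definition achieves (p : program) s (T : nat) (Q : state R -> Prop) : Prop :=
  exists t s', [/\ exec p s t s', t <= T & Q s'].

Lemma achieves_weaken p s T T' (Q Q' : state R -> Prop) :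
  achieves p s T Q -> T <= T' -> (forall s', Q s' -> Q' s') ->
  achieves p s T' Q'.
Proof.
move=> [t [s' [E le_t /[swap] le_T /[swap] QQ' /QQ' Qs']]].
by exists t, s'; split=> //; apply: leq_trans le_T.
Qed.

Lemma achieves_seq p q s T1 T2 (Q1 Q : state R -> Prop) :
  achieves p s T1 Q1 -> (forall s', Q1 s' -> achieves q s' T2 Q) ->
  achieves (Seq p q) s (T1 + T2) Q.
Proof.
move=> [t [s' [E le_t Qs' /(_ _ Qs')]]] [t' [s'' [E' le_t' Qs'']]].
exists (t + t'), s''; split=> //; [exact: exec_seq E E' | exact: leq_add].
Qed.

Lemma achieves_do a s (Q : state R -> Prop) :
  Q (run_instr a s) -> achieves (Do a) s 1 Q.
Proof. by exists 1, (run_instr a s); split=> //; exact: exec_do. Qed.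

Lemma achieves_straight l s (Q : state R -> Prop) :
  Q (foldl (fun s a => run_instr a s) s l) ->
  achieves (straight l) s (size l).+1 Q.
Proof.
elim: l s => [|a l IHl] s /= Qs.
  by exists 1, s; split=> //; exact: exec_skip.
by apply: (achieves_seq (T1 := 1) (achieves_do (Q := eq (run_instr a s)) _)) =>
  // _ <-; exact: IHl.
Qed.

Lemma achieves_if b p q s T (Q : state R -> Prop) :
  achieves (if run_test b s then p else q) s T Q ->
  achieves (If b p q) s T.+1 Q.
Proof.
move=> [t [s' []]]; case: ifP => bs E le_t Qs'; exists t.+1, s'; split=> //.
  exact: exec_if_true.
by apply: exec_if_false => //; rewrite bs.
Qed.

Definition keep (t : nat) s s' : Prop :=
  forall j, j < t -> nreg s' (treg j) = nreg s (treg j).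

(** This serves the final loop, which writes the result over the input cells. *)
Definition set_inp P io : params :=
  Params (npts P) (ncol P) (budget P) (ncode P) io (dle P).

Lemma set_inpE P : set_inp P (inp P) = P. Proof. by case: P. Qed.

Lemma bval_set_inp P io b : bval (set_inp P io) b = bval P b.
Proof. by case: b. Qed.

(** Temporaries and real registers are left free, so they can be overwritten at any time. *)
Record repr P x m s : Prop := Repr {
  repr_dle : forall c a b, dle P c a b = (d b <= d a *+ 2 ^ c)%R;
  repr_pts : nreg s 0 = npts P;
  repr_col : nreg s 1 = ncol P;
  repr_budget : nreg s 2 = budget P;
  repr_code : nreg s 3 = ncode P;
  repr_one : nreg s 4 = 1;
  repr_zero : nreg s 5 = 0;
  repr_var : forall v, nreg s (vreg v) = x v;
  repr_inp : forall a, a < ncode P -> narr s a = inp P a;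
  repr_mem : forall a i, narr s (ncode P + (16 * i + array_id a)) = m a i;
  repr_dist : rarr s =1 d
}.

Lemma repr_bound P x m s b : repr P x m s -> nreg s (breg b) = bval P b.
Proof. by case: b => -[]. Qed.

Definition set_nreg s i v : state R :=
  State (update (nreg s) i v) (narr s) (rreg s) (rarr s).

Definition set_rreg s i v : state R :=
  State (nreg s) (narr s) (update (rreg s) i v) (rarr s).

Lemma run_instrE s :
  (forall i c, run_instr (NConst i c) s = set_nreg s i c) *
  (forall i j k, run_instr (NAdd i j k) s = set_nreg s i (nreg s j + nreg s k)) *
  (forall i j k, run_instr (NSub i j k) s = set_nreg s i (nreg s j - nreg s k)) *
  (forall i j, run_instr (NLoad i j) s = set_nreg s i (narr s (nreg s j))) *
  (forall i j k, run_instr (RAdd i j k) s =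
                 set_rreg s i (rreg s j + rreg s k)%R) *
  (forall i j, run_instr (RLoad i j) s = set_rreg s i (rarr s (nreg s j))).
Proof. by case: s. Qed.

Lemma run_storeE i j s :
  run_instr (NStore i j) s =
  State (nreg s) (update (narr s) (nreg s i) (nreg s j)) (rreg s) (rarr s).
Proof. by case: s. Qed.

Lemma eq_treg t t' : (treg t == treg t') = (t == t').
Proof. by rewrite /treg; lia. Qed.
Lemma eq_vreg v v' : (vreg v == vreg v') = (v == v').
Proof. by rewrite /vreg; lia. Qed.
Lemma eq_vtreg v t : (vreg v == treg t) = false.
Proof. by rewrite /vreg /treg; lia. Qed.
Lemma eq_tvreg v t : (treg t == vreg v) = false.
Proof. by rewrite /vreg /treg; lia. Qed.
Lemma eq_treg_low r t : r < 6 -> (r == treg t) = false.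
Proof. by rewrite /treg; lia. Qed.
Lemma eq_vreg_low r v : r < 6 -> (r == vreg v) = false.
Proof. by rewrite /vreg; lia. Qed.
Lemma eq_breg_treg b t : (breg b == treg t) = false.
Proof. by case: b; rewrite /treg /=; lia. Qed.
Lemma eq_breg_vreg b t : (breg b == vreg t) = false.
Proof. by case: b; rewrite /vreg /=; lia. Qed.
Lemma eqSn n : (n.+1 == n) = false. Proof. lia. Qed.
Lemma eqnS n : (n == n.+1) = false. Proof. lia. Qed.

Definition regE := (eq_treg, eq_vreg, eq_vtreg, eq_tvreg, eq_breg_treg,
  eq_breg_vreg, eqSn, eqnS, eqxx).

Lemma repr_temp P x m s t w : repr P x m s -> repr P x m (set_nreg s (treg t) w).
Proof.
case=> dleP h0 h1 h2 h3 h4 h5 hv hi hm hd; split=> //=;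
  rewrite /update ?eq_treg_low // => v; rewrite ?regE //.
Qed.

Lemma repr_rreg P x m s i w : repr P x m s -> repr P x m (set_rreg s i w).
Proof. by case. Qed.

Lemma repr_var_set P x m s v w :
  repr P x m s -> repr P (update x v w) m (set_nreg s (vreg v) w).
Proof.
case=> dleP h0 h1 h2 h3 h4 h5 hv hi hm hd; split=> //=;
  rewrite /update ?eq_vreg_low // => v'; rewrite ?regE //.
by case: ifP.
Qed.

Lemma repr_ext P x x' m s : x =1 x' -> repr P x m s -> repr P x' m s.
Proof. by move=> xx' []; split=> // v; rewrite -xx'. Qed.

Lemma keep_trans t t' s1 s2 s3 :
  t <= t' -> keep t s1 s2 -> keep t' s2 s3 -> keep t s1 s3.
Proof. by move=> tt' k12 k23 j jt; rewrite k23 ?k12 //; apply: leq_trans tt'. Qed.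

Lemma keep_temp t t' s w : t <= t' -> keep t s (set_nreg s (treg t') w).
Proof.
by move=> tt' j jt; rewrite /= /update regE; case: eqP => // ej; move: jt tt';
  rewrite ej; lia.
Qed.

Lemma keep_var t v s w : keep t s (set_nreg s (vreg v) w).
Proof. by move=> j jt; rewrite /= /update regE. Qed.

(* [H] may only depend on the temporaries below [t] and on the array; unlike the
   registers of the loop, these may be modified by the body. *)
Lemma loop_ok P x (io : nat -> nat -> nat) (m : nat -> memory) v b t p T
    (H : nat -> state R -> Prop) :
  (forall i s s', keep t s s' -> narr s' = narr s -> H i s -> H i s') ->
  (forall i s, i < bval P b ->
     repr (set_inp P (io i)) (update x v i) (m i) s -> H i s ->
     achieves p s T (fun s' =>
       [/\ repr (set_inp P (io i.+1)) (update x v i) (m i.+1) s', H i.+1 s',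
           nreg s' (treg t) = nreg s (treg t) &
           nreg s' (treg t.+1) = nreg s (treg t.+1)])) ->
  forall s, repr (set_inp P (io 0)) x (m 0) s -> H 0 s ->
  achieves (loop v b t p) s (bval P b * (T + 4) + 6) (fun s' =>
    repr (set_inp P (io (bval P b))) x (m (bval P b)) s' /\ H (bval P b) s').
Proof.
move=> Hext Hp s reprs Hs; set B := bval P b.
pose J i s' := [/\ repr (set_inp P (io i)) (update x v i) (m i) s', H i s',
  nreg s' (treg t) = x v & nreg s' (treg t.+1) = i.+1].
(* Induction on the number [k] of rounds left; the additional unit of time pays for the failing
   test. *)
have HW k i s' : B = i + k -> J i s' ->
  achieves (While (NLe (treg t.+1) (breg b))
          (Seq p (straight [:: NAdd (vreg v) (vreg v) 4;
                               NAdd (treg t.+1) (treg t.+1) 4]))) s' (k * (T +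
                                 4) + 1) (J B).
  elim: k i s' => [|k IHk] i s' EB Js'.
    have [r _ _ Et] := Js'.
    exists 1, s'; split=> //; last by have ->: B = i by lia.
    by apply: exec_while_false; rewrite /= (repr_bound _ r) bval_set_inp Et; lia.
  have [r Hi E1 E2] := Js'.
  have iB : i < bval P b by rewrite -/B; lia.
  have [c1 [s1 [Ex1 le1 [r1 H1 F1 F2]]]] := Hp i s' iB r Hi.
  set s2 := set_nreg (set_nreg s1 (vreg v) i.+1) (treg t.+1) i.+2.
  have Ex2 : achieves (straight [:: NAdd (vreg v) (vreg v) 4;
                               NAdd (treg t.+1) (treg t.+1) 4]) s1 3 (eq s2).
    apply: achieves_straight; rewrite /= !run_instrE /= /update !regE.
    by rewrite eq_vreg_low // (repr_var r1) (repr_one r1) F2 E2 /update eqxx !addn1.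
  have J2 : J i.+1 s2.
    split.
    - apply: repr_temp; apply: repr_ext (repr_var_set v i.+1 r1).
      by move=> v'; rewrite /update; case: (v' == v).
    - apply: (Hext _ s1) H1 => //; apply: keep_trans (leqnn _) (keep_var _ _ _) _.
      exact: keep_temp.
    - by rewrite /s2 /= /update !regE F1.
    - by rewrite /s2 /= /update !regE.
  have [c2 [s3 [Ex3 le3 E3]]] := Ex2; rewrite E3 in J2.
  have [|c4 [s4 [Ex4 le4 Q4]]] := IHk i.+1 s3 _ J2; first lia.
  exists (c1 + c2 + c4).+1, s4; split=> //; last by lia.
  apply: exec_while_true Ex4; last exact: exec_seq Ex1 Ex3.
  by rewrite /= (repr_bound _ r) bval_set_inp E2.
set s1 := set_nreg (set_nreg (set_nreg s (treg t) (x v)) (vreg v) 0) (treg t.+1) 1.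
have J1 : J 0 s1.
  split.
  - by apply: repr_temp; apply: repr_var_set; apply: repr_temp.
  - apply: (Hext _ s) Hs => //.
    apply: keep_trans (leqnn _) (keep_temp _ _ (leqnn _)) _.
    apply: keep_trans (leqnn _) (keep_var _ _ _) _.
    exact: keep_temp.
  - by rewrite /s1 /= /update !regE.
  - by rewrite /s1 /= /update !regE.
apply: achieves_weaken _ _ (fun _ => id).
- apply: (achieves_seq (T1 := 4) (Q1 := eq s1)).
    apply: achieves_straight; rewrite /= !run_instrE /= /s1.
    by rewrite (repr_var reprs) (repr_zero reprs) addn0.
  move=> _ <-; apply: achieves_seq; first exact: (HW B 0 s1 (erefl _) J1).
  move=> s2 [r2 H2 E2 _].
  apply: achieves_do; rewrite run_instrE E2 (repr_zero r2) addn0; split.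
    apply: repr_ext (repr_var_set v (x v) r2) => v'; rewrite /update.
    by case: eqP => // ->.
  by apply: (Hext _ s2) H2 => //; exact: keep_var.
- by lia.
Qed.

Lemma addressE a t s :
  exists2 s', foldl (fun s i => run_instr i s) s (address a t) = s' &
  [/\ nreg s' (treg t) = nreg s 3 + (16 * nreg s (treg t) + array_id a),
     (forall x m P, repr P x m s -> repr P x m s'), keep t s s' &
     forall r, r != treg t -> r != treg t.+1 -> nreg s' r = nreg s r].
Proof.
eexists; first by []; rewrite /address /= !run_instrE /=.
split.
- by rewrite /update !regE !(eq_treg_low _ (r := 3)) // ; lia.
- by move=> x m P r; do !apply: repr_temp.
- by do 4![apply: keep_trans (leqnn _) (keep_temp _ _ (leqnn _)) _]; apply:
    keep_trans (leqnn _) (keep_temp _ _ (leqnn _)) _; apply: keep_trans (leqnn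
    _) (keep_temp _ _ (leqnSn _)) _; apply: keep_temp.
- by move=> r /negbTE rt /negbTE rt'; rewrite /= /update rt rt'.
Qed.

Lemma repr_result P x m s0 s t w w' : repr P x m s -> keep t s0 s -> w = w' ->
  [/\ repr P x m (set_nreg s (treg t) w), keep t s0 (set_nreg s (treg t) w)
    & nreg (set_nreg s (treg t) w) (treg t) = w'].
Proof.
move=> r k <-; split; [exact: repr_temp | | by rewrite /= /update eqxx].
exact: keep_trans (leqnn _) k (keep_temp _ _ (leqnn _)).
Qed.

Lemma doubling_ok P x m c t s : repr P x m s ->
  let s' := foldl (fun s i => run_instr i s) s (nseq c (RAdd 0 0 0)) in
  [/\ repr P x m s', keep t s s', rreg s' 0 = (rreg s 0 *+ 2 ^ c)%R
    & rreg s' 1 = rreg s 1].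
Proof.
elim: c s => [|c IHc] s rs /=; first by rewrite expn0 mulr1n.
rewrite run_instrE; set s1 := set_rreg _ _ _.
have [|r k E0 E1] := IHc s1; first exact: repr_rreg.
split=> //; rewrite E0 /= /update eqxx expnS mulnC.
by rewrite -mulr2n -mulrnA mulnC.
Qed.

(** By induction on the expression; [keep] protects a first operand in [treg t] while the second one
    is computed from [t.+1] on. *)
Lemma comp_ok P M : (forall b, bval P b <= M) -> forall e x m t s,
  repr P x m s ->
  achieves (comp t e) s (ecost M e) (fun s' =>
    [/\ repr P x m s', keep t s s' & nreg s' (treg t) = eval P x m e]).
Proof.
move=> leM.
have kS t s s1 s2 : keep t s s1 -> keep t.+1 s1 s2 -> keep t s s2.
  by move=> k1; apply: keep_trans k1.
elim=> [v|c| |b|e1 IH1 e2 IH2|e1 IH1 e2 IH2|a e1 IH1|e1 IH1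
  |e1 IH1 e2 IH2 e3 IH3 e4 IH4|c e1 IH1 e2 IH2|v b e1 IH1] x m t s rs /=.
- apply: achieves_do; rewrite run_instrE (repr_var rs) (repr_zero rs) addn0.
  exact: repr_result.
- by apply: achieves_do; rewrite run_instrE; exact: repr_result.
- apply: achieves_do; rewrite run_instrE (repr_budget rs) (repr_zero rs) addn0.
  exact: repr_result.
- apply: achieves_do; rewrite run_instrE (repr_bound _ rs) (repr_zero rs) addn0.
  exact: repr_result.
- rewrite -addnA; apply: achieves_seq (IH1 _ _ _ _ rs) _ => s1 [r1 k1 E1].
  apply: achieves_seq (IH2 _ _ t.+1 _ r1) _ => s2 [r2 k2 E2].
  apply: achieves_do; rewrite run_instrE E2 k2 // E1.
  by apply: repr_result => //; apply: kS k2.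
- rewrite -addnA; apply: achieves_seq (IH1 _ _ _ _ rs) _ => s1 [r1 k1 E1].
  apply: achieves_seq (IH2 _ _ t.+1 _ r1) _ => s2 [r2 k2 E2].
  apply: achieves_do; rewrite run_instrE E2 k2 // E1.
  by apply: repr_result => //; apply: kS k2.
- apply: achieves_seq (IH1 _ _ _ _ rs) _ => s1 [r1 k1 E1].
  apply: (achieves_straight (l := rcons (address a t) _)).
  rewrite foldl_rcons; have [s2 -> [E2 r2 k2 _]] := addressE a t s1.
  have r2s := r2 _ _ _ r1; rewrite run_instrE; apply: repr_result => //.
    exact: keep_trans k1 k2.
  by rewrite E2 (repr_code r1) (repr_mem r2s) E1.
- apply: achieves_seq (IH1 _ _ _ _ rs) _ => s1 [r1 k1 E1].
  apply: achieves_if => /=; rewrite (repr_code r1) E1; case: leqP => le_i.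
    by apply: achieves_do; rewrite run_instrE; exact: repr_result.
  by apply: achieves_do; rewrite run_instrE E1 (repr_inp r1) //; exact: repr_result.
- apply: (achieves_weaken (T := ecost M e1 + (ecost M e2 + (ecost M e3 + ecost
    M e4).+1)) _ _ (fun _ => id)); last by lia.
  apply: achieves_seq (IH1 _ _ _ _ rs) _ => s1 [r1 k1 E1].
  apply: achieves_seq (IH2 _ _ t.+1 _ r1) _ => s2 [r2 k2 E2].
  apply: achieves_if => /=; rewrite E2 k2 // E1; have k := kS _ _ _ _ k1 k2.
  case: ifP => _.
    apply: achieves_weaken (IH3 _ _ t _ r2) _ _; first by lia.
    by move=> s' [r' k' E']; split=> //; apply: keep_trans k'.
  apply: achieves_weaken (IH4 _ _ t _ r2) _ _; first by lia.
  by move=> s' [r' k' E']; split=> //; apply: keep_trans k'.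
- apply: (achieves_weaken (T := ecost M e1 + (ecost M e2 + (c.+3 + 2))) _ _
    (fun _ => id)); last by lia.
  apply: achieves_seq (IH1 _ _ _ _ rs) _ => s1 [r1 k1 E1].
  apply: achieves_seq (IH2 _ _ t.+1 _ r1) _ => s2 [r2 k2 E2].
  have k := kS _ _ _ _ k1 k2.
  apply: (achieves_seq (Q1 := fun s3 => [/\ repr P x m s3, keep t s s3,
     rreg s3 0 = (d (eval P x m e1) *+ 2 ^ c)%R & rreg s3 1 = d (eval P x m e2)])).
    pose l := [:: RLoad 0 (treg t), RLoad 1 (treg t.+1) & nseq c (RAdd 0 0 0)].
    have -> : c.+3 = (size l).+1 by rewrite /= size_nseq.
    apply: (achieves_straight (l := l)); rewrite /= !run_instrE /= !(repr_dist
      r2) E2 k2 // E1.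
    set s3 := set_rreg _ 1 _.
    have r3 : repr P x m s3 by do 2!apply: repr_rreg.
    have [r4 k4 F0 F1] := doubling_ok c t r3; split=> //.
    exact: keep_trans (leqnn _) (k : keep t s s3) k4.
  move=> s3 [r3 k3 F0 F1]; apply: achieves_if => /=.
  rewrite F0 F1 -(repr_dle r3); case: (dle _ _ _ _).
    by apply: achieves_do; rewrite run_instrE; exact: repr_result.
  by apply: achieves_do; rewrite run_instrE; exact: repr_result.
(* The partial sum stays in [treg t], the loop uses the next two temporaries, and the body starts at
   [t.+3]. *)
- set F := fun i : nat => eval P (update x v i) m e1.
  pose H i s' := keep t s s' /\ nreg s' (treg t) = \sum_(j < i) F j.
  apply: (achieves_weaken (T := 1 + (bval P b * ((ecost M e1 + 1) + 4) + 6)) _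
    _ (fun _ => id));
    last by have := leM b; nia.
  apply: (achieves_seq (Q1 := eq (set_nreg s (treg t) 0))).
    by apply: achieves_do; rewrite run_instrE.
  move=> _ <-.
  apply: achieves_weaken
    (loop_ok (P := P) (x := x) (io := fun=> inp P) (m := fun=> m) (H := H) _ _
      _ _) (leqnn _) _.
  - move=> i s1 s2 k12 _ [k1 E1]; split; last by rewrite k12.
    by apply: keep_trans k12.
  - move=> i s1 iB; rewrite set_inpE => r1 [k1 E1].
    apply: achieves_seq (IH1 _ _ t.+3 _ r1) _ => s2 [r2 k2 E2].
    apply: achieves_do; rewrite run_instrE E2 (k2 t) ?E1; last by lia.
    split.
    + exact: repr_temp.
    + split; last by rewrite big_ord_recr /= /update eqxx.
      apply: keep_trans (leqnn _) (keep_trans _ k1 k2) (keep_temp _ _ _) => //.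
      by lia.
    + by rewrite /= /update !regE k2.
    + by rewrite /= /update !regE; case: eqP => [|_]; [lia | rewrite k2].
  - by rewrite /= set_inpE; apply: repr_temp.
  - split; last by rewrite big_ord0 /= /update eqxx.
    exact: keep_temp.
  - by move=> s'; rewrite set_inpE => -[r' [k' E']].
Qed.

Lemma ccomp_ok P M : (forall b, bval P b <= M) -> forall c x m t s,
  repr P x m s ->
  achieves (ccomp t c) s (ccost M c) (fun s' =>
    repr P x (run P x c m) s' /\ keep t s s').
Proof.
move=> leM; elim=> [a e1 e2|c1 IH1 c2 IH2|v b c1 IH1] x m t s rs /=.
- apply: (achieves_weaken (T := ecost M e1 + (ecost M e2 + 10)) _ _ (fun _ => id));
    last by lia.
  apply: achieves_seq (comp_ok leM _ t rs) _ => s1 [r1 k1 E1].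
  apply: achieves_seq (comp_ok leM _ t.+1 r1) _ => s2 [r2 k2 E2].
  have [l El] : exists l, l = rcons (address a t) (NStore (treg t) (treg t.+2)).
    by eexists.
  apply: (achieves_straight (l := _ :: rcons (address a t) _)).
  rewrite -El /= El run_instrE foldl_rcons E2 (repr_zero r2) addn0.
  set s3 := set_nreg _ _ _; have r3 : repr P x m s3 by exact: repr_temp.
  have k3 : keep t.+1 s2 s3 by exact: keep_temp.
  have [s4 -> [E4 r4 k4 F4]] := addressE a t s3.
  have {r4}r4 := r4 _ _ _ r3; rewrite run_storeE; split; last first.
    move=> j jt; rewrite /= k4 // k3 ?k2 ?k1 //; exact: leqW.
  have -> : nreg s4 (treg t.+2) = eval P x m e2.
    by rewrite F4 ?eq_treg; [rewrite /= /update eqxx | lia | lia].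
  rewrite E4 (repr_code r3) k3 // k2 // E1.
  case: r4 => *; split=> //= [i' i'K|a' i'].
    (* Array cells have addresses from [ncode P] on, so the input is intact. *)
    by rewrite /update; case: eqP => [|_ ]; [lia | auto].
  rewrite /mem_set /update eqn_add2l.
  (* Identifiers below 16 keep the cells of different arrays apart. *)
  have lt_a := array_id_lt a; have lt_a' := array_id_lt a'.
  case: (eqVneq (array_id a') (array_id a)) => [ea|na].
    have ea' := array_id_inj ea; rewrite ea'; case: (eqVneq i' _) => [->|ni].
      by rewrite eqxx.
    by case: eqP => [|_]; [lia | rewrite -ea'].
  by case: eqP => [|_]; [lia | auto].
- by apply: achieves_seq (IH1 _ _ t _ rs) _ => s1 [r1 k1]; apply:
    achieves_weaken (IH2 _ _ t _ r1) _ _ => // s2 [r2 k2]; split=> //; apply: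
    keep_trans k2.
- apply: (achieves_weaken (T := bval P b * (ccost M c1 + 4) + 6) _ _ (fun _ => id));
    last by have := leM b; nia.
  pose H (i : nat) s' := keep t s s'.
  apply: achieves_weaken
    (loop_ok (P := P) (x := x) (io := fun=> inp P) (m := fun i => iteri i (fun
      i => run P (update x v i) c1) m) (H := H) _ _ _ _) (leqnn _) _.
  - by move=> i s1 s2 k12 _ k1; apply: keep_trans k12.
  - move=> i s1 iB; rewrite set_inpE => r1 k1.
    apply: achieves_weaken (IH1 _ _ t.+2 _ r1) (leqnn _) _ => s2 [r2 k2].
    split; [by [] | | by apply: k2; lia | by apply: k2; lia].
    by apply: keep_trans k1 k2; lia.
  - by rewrite set_inpE.
  - by [].
  - by move=> s'; rewrite set_inpE.
Qed.

End Compiler.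

(** * Frame properties, loop rules and loops that fill an array *)

Fixpoint reads (a : array) (e : expr) : bool :=
  match e with
  | EVar _ | ECst _ | EBudget | EBound _ => false
  | EAdd e1 e2 | ESub e1 e2 | ECmp _ e1 e2 => reads a e1 || reads a e2
  | ELoad a' e1 => (array_id a == array_id a') || reads a e1
  | EIn e1 | ESum _ _ e1 => reads a e1
  | EIf e1 e2 e3 e4 => [|| reads a e1, reads a e2, reads a e3 | reads a e4]
  end.

Fixpoint writes (a : array) (c : cmd) : bool :=
  match c with
  | CStore a' _ _ => array_id a == array_id a'
  | CSeq c1 c2 => writes a c1 || writes a c2
  | CFor _ _ c1 => writes a c1
  end.

Lemma eval_agree P m m' e :
  (forall a, reads a e -> m a =1 m' a) -> forall x, eval P x m e = eval P x m' e.
Proof.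
elim: e => [v|c| |b|e1 IH1 e2 IH2|e1 IH1 e2 IH2|a e1 IH1|e1 IH1
  |e1 IH1 e2 IH2 e3 IH3 e4 IH4|c e1 IH1 e2 IH2|v b e1 IH1] //= h x.
- by rewrite IH1 ?IH2 // => a ha; apply: h; rewrite ha ?orbT.
- by rewrite IH1 ?IH2 // => a ha; apply: h; rewrite ha ?orbT.
- by rewrite IH1 => [|a' ha']; apply: h; rewrite ?eqxx ?ha' ?orbT.
- by rewrite IH1.
- by rewrite IH1 ?IH2 ?IH3 ?IH4 // => a ha; apply: h; rewrite ha ?orbT.
- by rewrite IH1 ?IH2 // => a ha; apply: h; rewrite ha ?orbT.
- by apply: eq_bigr => i _; rewrite IH1.
Qed.

Lemma mem_set_neq m a f a' : array_id a' != array_id a -> mem_set m a f a' = m a'.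
Proof. by rewrite /mem_set => /negbTE ->. Qed.

Lemma mem_set_eq m a f : mem_set m a f a = f.
Proof. by rewrite /mem_set eqxx. Qed.

Lemma run_frame P a c : ~~ writes a c -> forall x m, run P x c m a = m a.
Proof.
elim: c => [a' e1 e2|c1 IH1 c2 IH2|v b c1 IH1] /=.
- by move=> ne x m; rewrite mem_set_neq.
- by rewrite negb_or => /andP[h1 h2] x m; rewrite IH2 ?IH1.
- by move=> h x m; elim: (bval P b) => //= k IHk; rewrite IH1.
Qed.

Lemma run_for_inv P x v b c (I : nat -> memory -> Prop) m : I 0 m ->
  (forall i m', i < bval P b -> I i m' -> I i.+1 (run P (update x v i) c m')) ->
  I (bval P b) (run P x (CFor v b c) m).
Proof.
move=> I0 IS /=; have : bval P b <= bval P b by [].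
elim: {-2}(bval P b) => //= k IHk kB; apply: IS => //; exact: IHk (ltnW kB).
Qed.

(** The rule for exhaustive search: [I] leads to round [i0], this round establishes [G], and all
    later rounds keep it. *)
Lemma run_for_hit P x v b c (I G : memory -> Prop) m i0 : I m -> i0 < bval P b ->
  (forall i m', i < bval P b -> I m' -> I (run P (update x v i) c m')) ->
  (forall i m', i < bval P b -> G m' -> G (run P (update x v i) c m')) ->
  (forall m', I m' -> G (run P (update x v i0) c m')) ->
  G (run P x (CFor v b c) m).
Proof.
move=> Im i0B IS GS hit.
have [|i m' iB [Im' h]|_] //= := @run_for_inv P x v b c (fun i m' => I m' /\
  (i0 < i -> G m')) m.
  split; first exact: IS.
  rewrite ltnS leq_eqVlt => /predU1P[<-|/h Gm']; [exact: hit | exact: GS].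
by apply.
Qed.

Lemma run_store_loop P x v b a e m : ~~ reads a e -> forall i,
  run P x (CFor v b (CStore a (EVar v) e)) m a i =
  if i < bval P b then eval P (update x v i) m e else m a i.
Proof.
move=> ra.
have [] // := @run_for_inv P x v b (CStore a (EVar v) e) (fun k m' =>
  (forall a', array_id a' != array_id a -> m' a' = m a') /\
  (forall i, m' a i = if i < k then eval P (update x v i) m e else m a i)) m.
move=> k m' kB [fr h]; split=> [a' ne|i] /=.
  by rewrite mem_set_neq ?fr.
rewrite mem_set_eq {1}/update {1}/update eqxx ltnS leq_eqVlt.
case: eqP => [->|_] /=; last exact: h.
apply: eval_agree => a' ra'; rewrite fr //.
by apply: contraNneq ra => /array_id_inj <-.
Qed.

(* The detour through [Tmp] makes the assignments simultaneous: [e] may read [a]. *)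
Definition fill (a : array) (v : nat) (b : bound) (e : expr) : cmd :=
  CSeq (CFor v b (CStore Tmp (EVar v) e))
       (CFor v b (CStore a (EVar v) (ELoad Tmp (EVar v)))).

Lemma run_fill P x v b a e m : ~~ reads Tmp e -> array_id a != 0 -> forall i,
  run P x (fill a v b e) m a i =
  if i < bval P b then eval P (update x v i) m e else m a i.
Proof.
move=> re a0 i; set m1 := run P x (CFor v b (CStore Tmp (EVar v) e)) m.
rewrite -[LHS]/(run P x (CFor v b (CStore a (EVar v) (ELoad Tmp (EVar v)))) m1 a i).
rewrite run_store_loop /= ?orbF // {2}/m1 run_frame //.
by case: ifP => // iB; rewrite /update eqxx /m1 run_store_loop // iB.
Qed.

(** A row-major index; as there is no multiplication, the product with the number of points is a sum
    of equal terms. *)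
Definition pairE (u v : nat) : expr :=
  EAdd (ESum 20 Points (EVar u)) (EVar v).

Lemma eval_pair P x m u v : u != 20 ->
  eval P x m (pairE u v) = npts P * x u + x v.
Proof.
move=> u20 /=; congr (_ + _); rewrite (eq_bigr (fun=> x u)) ?sum_nat_const ?card_ord //.
by move=> i _; rewrite /update (negbTE u20).
Qed.

Definition store2 v1 b1 v2 a e :=
  CFor v1 b1 (CFor v2 Points (CStore a (pairE v1 v2) e)).

Lemma run_store_loop2 P x (v1 : nat) b1 (v2 : nat) a e m :
  ~~ reads a e -> v1 != 20 -> v2 != v1 -> v2 != 20 -> forall c u,
  c < bval P b1 -> u < npts P ->
  run P x (store2 v1 b1 v2 a e) m a (npts P * c + u) =
  eval P (update (update x v1 c) v2 u) m e.
Proof.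
move=> ra v120 v21 v220 c u cB un.
pose n := npts P; pose val c u := eval P (update (update x v1 c) v2 u) m e.
have agree m' : (forall a', array_id a' != array_id a -> m' a' = m a') ->
    forall x', eval P x' m' e = eval P x' m e.
  move=> fr x'; apply: eval_agree => a' ra'; rewrite fr //.
  by apply: contraNneq ra => /array_id_inj <-.
pose others m' := forall a', array_id a' != array_id a -> m' a' = m a'.
pose I1 k m' := others m' /\
  forall c u, c < k -> u < n -> m' a (n * c + u) = val c u.
pose I2 k j m' := others m' /\ forall c u, u < n -> c < k \/ c = k /\ u < j ->
  m' a (n * c + u) = val c u.
pose body := CStore a (pairE v1 v2) e.
suff hS k m' : k < bval P b1 -> I1 k m' ->
    I1 k.+1 (run P (update x v1 k) (CFor v2 Points body) m').
  have h0 : I1 0 m by split.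
  by have [_ h] := run_for_inv h0 hS; exact: h.
move=> {cB un c u} kB [fr hk].
have h0 : I2 k 0 m' by split=> // c u un [ck|[_]] //; exact: hk.
suff hS j m'' : j < n -> I2 k j m'' ->
    I2 k j.+1 (run P (update (update x v1 k) v2 j) body m'').
  have [fr2 h] := run_for_inv (b := Points) h0 hS.
  split=> // c u; rewrite ltnS leq_eqVlt => /predU1P[->|ck] un; apply: h => //.
    by right.
  by left.
move=> jn [fr'' hj]; split=> [a' ne|c u un cu].
  by rewrite /= mem_set_neq ?fr''.
set x' := update _ v2 j.
rewrite -[run _ _ _ _]/(mem_set m'' a
  (update (m'' a) (eval P x' m'' (pairE v1 v2)) (eval P x' m'' e))).
rewrite mem_set_eq eval_pair // agree // /x'.
rewrite /update; rewrite eqxx [v1 == v2]eq_sym (negbTE v21) eqxx -/n.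
case: eqP => [e1|ne1].
  (* Distinct pairs have distinct addresses, by division with remainder by [n]. *)
  have [-> ->] : c = k /\ u = j.
    have n0 : 0 < n by apply: leq_trans un.
    have := congr1 (divn^~ n) e1; have := congr1 (modn^~ n) e1.
    by rewrite !(mulnC n) !modnMDl !divnMDl // !divn_small // !modn_small // !addn0.
  by [].
apply: hj => //; case: cu => [|[ck uj]]; first by left.
by right; split=> //; move: uj; rewrite ltnS leq_eqVlt => /predU1P[euj|//];
  case: ne1; rewrite euj ck.
Qed.

Definition fill2 (a : array) (v1 : nat) (b1 : bound) (v2 : nat) (e : expr) : cmd :=
  CSeq (store2 v1 b1 v2 Tmp e) (store2 v1 b1 v2 a (ELoad Tmp (pairE v1 v2))).

Lemma run_fill2 P x (v1 : nat) b1 (v2 : nat) a e m :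
  ~~ reads Tmp e -> array_id a != 0 -> v1 != 20 -> v2 != v1 -> v2 != 20 ->
  forall c u, c < bval P b1 -> u < npts P ->
  run P x (fill2 a v1 b1 v2 e) m a (npts P * c + u) =
  eval P (update (update x v1 c) v2 u) m e.
Proof.
move=> re a0 v120 v21 v220 c u cB un.
have -> : run P x (fill2 a v1 b1 v2 e) m = run P x (store2 v1 b1 v2 a (ELoad
  Tmp (pairE v1 v2)))
  (run P x (store2 v1 b1 v2 Tmp e) m) by [].
rewrite run_store_loop2 //=; last by rewrite orbF.
rewrite -[LHS]/(run P x (store2 v1 b1 v2 Tmp e) m Tmp (eval P (update (update x
  v1 c) v2 u) (run P x (store2 v1 b1 v2 Tmp e) m) (pairE v1 v2))).
rewrite eval_pair // {1 3}/update eqxx [v1 == v2]eq_sym (negbTE v21) {1}/update eqxx.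
exact: run_store_loop2.
Qed.

(** * The algorithm *)

(** Truth values are naturals: 0 is false, everything positive is true. *)
Definition ELe e1 e2 := EIf e1 e2 (ECst 1) (ECst 0).
Definition ELt e1 e2 := ELe (EAdd e1 (ECst 1)) e2.
Definition EWhen e1 e2 := EIf (ECst 1) e1 e2 (ECst 0).
Definition EAnd e1 e2 := EWhen e1 (ELe (ECst 1) e2).
Definition EOr e1 e2 := ELe (ECst 1) (EAdd e1 e2).
Definition ENot e1 := ELe e1 (ECst 0).
Definition EEx v b e := ELe (ECst 1) (ESum v b e).
Definition EAll v b e := ENot (EEx v b (ENot e)).
Definition ld a v := ELoad a (EVar v).
Definition ld0 a := ELoad a (ECst 0).
Definition store0 a e := CStore a (ECst 0) e.
(* [EBase] and [pairE] bind the variable 20, so their arguments must not use it. *)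
Definition EBase e := EAdd (ESum 20 Points e) e.

(** Variables 0 and 1 hold the pair defining the radius, 2 and 3 count iterations, 4 is the mode, 5
    the coded guess, 6 a sum of weights; those from 10 on belong to inner loops and sums. *)
Definition radE := pairE 0 1.
Definition nearE c u v := ECmp c radE (pairE u v).
Definition colE l u := EIn (EAdd (EBound Colors) (pairE l u)).
Definition demE l := EIn (EVar l).

Definition massE := ESum 11 Points (EWhen (nearE 0 10 11) (ld Price 11)).
Definition betterE u v :=
  EOr (ELt (ld Mass v) (ld Mass u))
    (EAnd (EAnd (ELe (ld Mass u) (ld Mass v)) (ELe (ld Mass v) (ld Mass u)))
          (ELt (EVar u) (EVar v))).
Definition selE :=
  ENot (EEx 11 Points
    (EAnd (betterE 11 10) (EAnd (nearE 2 11 10) (ld Sel 11)))).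
Definition claimsE s u :=
  EAnd (ld Sel s) (EAnd (nearE 2 s u) (ELe (ld Mass u) (ld Mass s))).
Definition ownsE s u :=
  EAnd (claimsE s u)
    (ENot (EEx 15 Points (EAnd (ELt (EVar 15) (EVar s)) (claimsE 15 u)))).
Definition guessedE u := EEx 16 Points (EAnd (ld Guess 16) (nearE 0 16 u)).
Definition clusterE s u :=
  EAnd (EIf (EVar 4) (ECst 0) (ownsE s u) (EAnd (ld Sel s) (nearE 1 s u)))
    (ENot (guessedE u)).
Definition coverE s l := ESum 17 Points (EAnd (clusterE s 17) (colE l 17)).

(** The quotient by [n + 1] is the number of [j] for which [(j + 1) * (n + 1)] is at most the
    code. *)
Definition quotE := ESum 14 Codes (ELe (EBase (EAdd (EVar 14) (ECst 1))) (ld0 Code)).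
Definition remE := ESub (ld0 Code) (EBase quotE).

(* Decodes variable 5 in base [n + 1]; the digit [n] stands for no point. *)
Definition guess :=
  CSeq (store0 Code (EVar 5))
  (CSeq (fill Guess 10 Points (ECst 0))
    (CFor 13 Colors
      (CSeq (fill Guess 10 Points
              (EOr (ld Guess 10)
                 (EAnd (ELe remE (EVar 10)) (ELe (EVar 10) remE))))
            (store0 Code quotE)))).

(* The weight of a cluster has the digit 1, which counts clusters, followed by
   the number of points of each color.  Clusters are disjoint, so sums of weights
   have no carries. *)
Definition weigh :=
  CSeq (fill Weight 12 Points (ECst 1))
    (CFor 13 Colors
      (fill Weight 12 Points (EAdd (EBase (ld Weight 12)) (coverE 12 13)))).

Definition extendE :=
  EAnd (ELe (ld Weight 18) (EVar 6))
       (ELoad Reach (ESub (EVar 6) (ld Weight 18))).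

(* [Reach] marks the sums of weights of sets of clusters, and row [c] of [Wit]
   holds such a set for the sum [c]. *)
Definition subset_sums :=
  CSeq (fill Reach 6 Codes (ENot (EVar 6)))
  (CSeq (fill2 Wit 6 Codes 10 (ECst 0))
    (CFor 18 Points
      (CSeq (fill2 Wit 6 Codes 10
              (EIf (ECst 1) extendE
                 (EOr (EAnd (ELe (EVar 10) (EVar 18)) (ELe (EVar 18) (EVar 10)))
                    (ELoad Wit (EAdd (ESum 20 Points (ESub (EVar 6) (ld Weight 18)))
                                     (EVar 10))))
                 (ELoad Wit (pairE 6 10))))
            (fill Reach 6 Codes (EOr extendE (ld Reach 6)))))).

Definition validE :=
  EAnd (ELe (ESum 10 Points (ELe (ECst 1) (ld Cand 10))) EBudget)
    (EAll 13 Colors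
      (ELe (demE 13)
        (ESum 10 Points
          (EAnd (colE 13 10)
            (EEx 11 Points (EAnd (ld Cand 11) (nearE 2 11 10))))))).

(** [Best] holds the address of a distance, because arrays hold only naturals. *)
Definition attempt :=
  CSeq (fill Cand 10 Points (EOr (ld Guess 10) (ELoad Wit (pairE 6 10))))
  (CSeq (store0 Ok
          (EAnd validE (EOr (ENot (ld0 Found)) (ECmp 0 (ld0 Best) radE))))
  (CSeq (fill Out 10 Points (EIf (ECst 1) (ld0 Ok) (ld Cand 10) (ld Out 10)))
  (CSeq (store0 Best (EIf (ECst 1) (ld0 Ok) radE (ld0 Best)))
        (store0 Found (EOr (ld0 Ok) (ld0 Found)))))).

Definition coreE v := EEx 12 Points (EAnd (ld Sel 12) (nearE 0 12 v)).
(** The scale N of the prices is the number of codes, so that multiplication by it is a sum over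
    [Codes]. *)
Definition cutE :=
  ELe (ESum 19 Codes (ESub (EAdd EBudget (ECst 1)) (EBound Colors)))
      (ESum 11 Points (EWhen (coreE 11) (ld Price 11))).
Definition cappedE u := EIf (ld Mass u) (EBound Codes) (ld Mass u) (EBound Codes).
Definition violE l :=
  ELe (EAdd (ESum 16 Points (EWhen (colE l 16) (cappedE 16))) (EBound Codes))
      (ESum 19 Codes (demE l)).
Definition raiseE v :=
  ESum 13 Colors (EWhen (violE 13)
    (ESum 12 Points
      (EWhen (EAnd (colE 13 12) (ELt (ld Mass 12) (EBound Codes)))
         (nearE 0 12 v)))).

Definition adjust :=
  fill Price 10 Points
    (EIf (ECst 1) cutE (ESub (ld Price 10) (coreE 10))
       (EAdd (ld Price 10) (raiseE 10))).

Definition select :=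
  CSeq (fill Mass 10 Points massE) (CFor 18 Points (fill Sel 10 Points selE)).

(** Two modes are wanted; the loop over [Points] provides them as soon as there are two points. *)
Definition try_all :=
  CFor 4 Points (CFor 5 Codes
    (CSeq guess (CSeq weigh (CSeq subset_sums (CFor 6 Codes attempt))))).

(* The radius is the distance between the points in variables 0 and 1. *)
Definition search_radius :=
  CSeq (fill Price 10 Points (ECst 0))
    (CFor 2 Codes (CFor 3 Codes (CSeq select (CSeq try_all adjust)))).

Definition search :=
  CSeq (store0 Found (ECst 0))
  (CSeq (fill Out 10 Points (ECst 0))
    (CFor 0 Points (CFor 1 Points search_radius))).

(** * Values of the expressions of the algorithm *)

Section Expressions.
Variable P : params.
Notation n := (npts P).
Notation g := (ncol P).
Notation K := (ncode P).
Implicit Types (x : nat -> nat) (m : memory).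

Lemma eval_le x m e1 e2 : eval P x m (ELe e1 e2) = (eval P x m e1 <= eval P x m e2).
Proof. by rewrite /=; case: (_ <= _). Qed.

Lemma eval_lt x m e1 e2 : eval P x m (ELt e1 e2) = (eval P x m e1 < eval P x m e2).
Proof. by rewrite eval_le /= addn1. Qed.

Lemma eval_when x m e1 e2 :
  eval P x m (EWhen e1 e2) = if 0 < eval P x m e1 then eval P x m e2 else 0.
Proof. by []. Qed.

Lemma eval_and x m e1 e2 :
  eval P x m (EAnd e1 e2) = (0 < eval P x m e1) && (0 < eval P x m e2).
Proof. by rewrite eval_when eval_le; case: (0 < _). Qed.

Lemma eval_or x m e1 e2 :
  eval P x m (EOr e1 e2) = (0 < eval P x m e1) || (0 < eval P x m e2).
Proof. by rewrite eval_le /= addn_gt0. Qed.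

Lemma eval_not x m e : eval P x m (ENot e) = ~~ (0 < eval P x m e).
Proof. by rewrite eval_le /= -leqNgt. Qed.

Lemma eval_le_congr x m e1 e2 i j : eval P x m e1 = i -> eval P x m e2 = j ->
  eval P x m (ELe e1 e2) = (i <= j).
Proof. by move=> <- <-; exact: eval_le. Qed.

Lemma eval_add_congr x m e1 e2 i j : eval P x m e1 = i -> eval P x m e2 = j ->
  eval P x m (EAdd e1 e2) = i + j.
Proof. by move=> <- <-. Qed.

Lemma eval_and_congr x m e1 e2 (i j : bool) : eval P x m e1 = i -> eval P x m e2 = j ->
  eval P x m (EAnd e1 e2) = i && j.
Proof. by move=> e1i e2j; rewrite eval_and e1i e2j !lt0b. Qed.

Lemma eval_sum x m v b e F :
  (forall i : 'I_(bval P b), eval P (update x v i) m e = F i) ->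
  eval P x m (ESum v b e) = \sum_i F i.
Proof. by move=> eF /=; apply: eq_bigr => i _. Qed.
Arguments eval_sum {x m v b e F}.

Lemma eval_ex x m v b e F :
  (forall i : 'I_(bval P b), eval P (update x v i) m e = nat_of_bool (F i)) ->
  eval P x m (EEx v b e) = [exists i, F i].
Proof.
move=> eF; rewrite eval_le (eval_sum eF); congr nat_of_bool.
apply/idP/existsP => [|[i Fi]]; last by rewrite (bigD1 i) //= Fi.
rewrite lt0n sum_nat_eq0 => /forallPn[i]; rewrite negb_imply eqb0 negbK => /andP[_ Fi].
by exists i.
Qed.
Arguments eval_ex {x m v b e F}.

Lemma eval_all x m v b e F :
  (forall i : 'I_(bval P b), eval P (update x v i) m e = nat_of_bool (F i)) ->
  eval P x m (EAll v b e) = [forall i, F i].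
Proof.
move=> eF; rewrite eval_not (@eval_ex _ _ _ _ _ (fun i => ~~ F i)).
  by rewrite lt0b negb_exists; congr nat_of_bool; apply: eq_forallb => i; rewrite negbK.
by move=> i; rewrite eval_not eF lt0b.
Qed.
Arguments eval_all {x m v b e F}.

Definition nearby c p : rel 'I_n := fun u v => dle P c p (n * u + v).
Definition rad x := n * x 0 + x 1.
Definition color_set (l : 'I_g) : {set 'I_n} := [set u : 'I_n | 0 < inp P (g +
  (n * l + u))].
Definition dem (l : 'I_g) : nat := inp P l.
(** All demands and color entries of the input lie below [K], where [EIn] can read them. *)
Hypothesis room : g + g * n <= K.

Lemma eval_rad x m : eval P x m radE = rad x. Proof. exact: eval_pair. Qed.

Lemma eval_near x m c (u v : nat) (i j : 'I_n) : u != 20 -> x u = i -> x v = j ->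
  eval P x m (nearE c u v) = nearby c (rad x) i j.
Proof.
move=> u20 xi xj.
rewrite -[LHS]/(nat_of_bool (dle P c (eval P x m radE) (eval P x m (pairE u v)))).
by rewrite eval_rad eval_pair // xi xj.
Qed.
Arguments eval_near {x} m {c u v i j}.

Lemma eval_col x m (l u : nat) (i : 'I_g) (j : 'I_n) : l != 20 -> x l = i -> x u = j ->
  eval P x m (colE l u) = inp P (g + (n * i + j)).
Proof.
move=> l20 xi xj.
rewrite -[LHS]/(let a := g + eval P x m (pairE l u) in if K <= a then 0 else inp P a).
rewrite eval_pair // xi xj /=; case: leqP => //.
by have := ltn_ord i; have := ltn_ord j; nia.
Qed.
Arguments eval_col {x} m {l u i j}.

Lemma eval_dem x m (l : nat) (i : 'I_g) : x l = i -> eval P x m (demE l) = dem i.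
Proof. by move=> xi /=; rewrite xi; case: leqP => //; have := ltn_ord i; nia. Qed.
Arguments eval_dem {x} m {l i}.

Lemma eval_mass x m (i : 'I_n) : x 10 = i ->
  eval P x m massE = mass (nearby 0 (rad x)) (fun v => m Price v) i.
Proof.
move=> xi; rewrite /mass big_mkcond; apply: eval_sum => j.
by rewrite eval_when (eval_near m (i := i) (j := j)) // lt0b.
Qed.

Section Selection.
Variables (p : nat) (Y : 'I_n -> nat) (m : memory).
Hypothesis massP : forall u : 'I_n, m Mass u = mass (nearby 0 p) Y u.
Notation sel := (fun u : 'I_n => 0 < m Sel u).
Notation betterY := (better (nearby 0 p) Y).

Lemma eval_better x (u v : nat) (i j : 'I_n) : x u = i -> x v = j ->
  eval P x m (betterE u v) = betterY i j.
Proof.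
move=> xi xj; rewrite eval_or !eval_and !eval_lt !eval_le /= xi xj.
by rewrite !massP !lt0b -eqn_leq.
Qed.
Arguments eval_better {x u v i j}.

Lemma eval_sel x (i : 'I_n) : x 10 = i -> rad x = p ->
  eval P x m selE = ~~ [exists v, [&& betterY v i, nearby 2 p v i & 0 < m Sel v]].
Proof.
move=> xi xp; rewrite eval_not (eval_ex (b := Points) (F := fun v => [&&
  betterY v i, nearby 2 p v i & 0 < m Sel v])) ?lt0b ?lt0b //.
move=> v; rewrite eval_and (eval_better (i := v) (j := i)) // eval_and.
by rewrite (eval_near m (i := v) (j := i)) // !lt0b -xp.
Qed.

Lemma eval_claims x (s u : nat) (i j : 'I_n) : s != 20 -> x s = i -> x u = j ->
  rad x = p ->
  eval P x m (claimsE s u) = claims (nearby 0 p) (nearby 2 p) Y sel i j.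
Proof.
move=> s20 xi xj xp; rewrite eval_and eval_and (eval_near m (i := i) (j := j)) //.
by rewrite eval_le /= xi xj !massP !lt0b xp.
Qed.
Arguments eval_claims {x s u i j}.

Lemma eval_owns x (s u : nat) (i j : 'I_n) : s != 20 -> s != 15 -> u != 15 ->
  x s = i -> x u = j -> rad x = p ->
  eval P x m (ownsE s u) = owns (nearby 0 p) (nearby 2 p) Y sel i j.
Proof.
move=> s20 s15 u15 xi xj xp; rewrite eval_and (eval_claims (i := i) (j := j)) //.
rewrite eval_not (eval_ex (b := Points) (F := fun s' : 'I_n => (s' < i) &&
  claims (nearby 0 p) (nearby 2 p) Y sel s' j)) ?lt0b ?lt0b //.
move=> v; rewrite eval_and eval_lt (eval_claims (i := v) (j := j)) //.
  by rewrite !lt0b /= {1 2}/update (negbTE s15) xi.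
by rewrite /update (negbTE u15).
Qed.
Arguments eval_owns {x s u i j}.

Definition guessed : {set 'I_n} := [set u : 'I_n | 0 < m Guess u].

Lemma eval_guessed x (u : nat) (j : 'I_n) : u != 16 -> x u = j -> rad x = p ->
  eval P x m (guessedE u) = (j \in ball1 (nearby 0 p) guessed).
Proof.
move=> u16 xj xp; rewrite inE; apply: eval_ex => v.
rewrite eval_and (eval_near m (i := v) (j := j)) // ?lt0b; last first.
  by rewrite /update (negbTE u16).
by rewrite inE -xp.
Qed.
Arguments eval_guessed {x u j}.

(* Mode 0 is for rounding, the other modes are for completing a guess. *)
Definition cluster (mode : nat) (i : 'I_n) : {set 'I_n} :=
  if mode == 0 then [set u | owns (nearby 0 p) (nearby 2 p) Y sel i u]
  else [set u | sel i && nearby 1 p i u].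

Lemma eval_cluster x (s u : nat) (i j : 'I_n) :
  [&& s != 20, s != 15, u != 15 & u != 16] -> x s = i -> x u = j -> rad x = p ->
  eval P x m (clusterE s u) = (j \in cluster (x 4) i :\: ball1 (nearby 0 p) guessed).
Proof.
case/and4P => s20 s15 u15 u16 xi xj xp; rewrite eval_and eval_not.
rewrite (eval_guessed (j := j)) // !lt0b in_setD.
suff -> : eval P x m (EIf (EVar 4) (ECst 0) (ownsE s u) (EAnd (ld Sel s) (nearE
  1 s u))) =
  (j \in cluster (x 4) i) by rewrite lt0b andbC.
rewrite -[LHS]/(if x 4 <= 0 then eval P x m (ownsE s u) else eval P x m (EAnd
  (ld Sel s) (nearE 1 s u))).
rewrite leqn0 /cluster; case: eqP => _; rewrite inE.
  by rewrite (eval_owns (i := i) (j := j)).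
by rewrite eval_and (eval_near m (i := i) (j := j)) //= xi !lt0b xp.
Qed.
Arguments eval_cluster {x s u i j}.

Lemma eval_cover x (s l : nat) (i : 'I_n) (c : 'I_g) :
  [&& s != 20, s != 15, s != 17, l != 20 & l != 17] -> x s = i -> x l = c ->
    rad x = p ->
  eval P x m (coverE s l) =
  #|(cluster (x 4) i :\: ball1 (nearby 0 p) guessed) :&: color_set c|.
Proof.
case/and5P => s20 s15 s17 l20 l17 xi xl xp.
rewrite -sum1_card big_mkcond; apply: eval_sum => u.
rewrite eval_and (eval_cluster (i := i) (j := u)) ?s20 ?s15 //; last first.
  by rewrite /update (negbTE s17).
rewrite (eval_col m (i := c) (j := u)) //; last by rewrite /update (negbTE l17).
by rewrite in_setI [u \in color_set c]inE lt0b; case: (_ && _).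
Qed.
Arguments eval_cover {x s l i c}.

End Selection.

Lemma eval_core x m (v : nat) (j : 'I_n) : v != 12 -> x v = j ->
  eval P x m (coreE v) = (j \in core (nearby 0 (rad x)) (fun u : 'I_n => 0 < m Sel u)).
Proof.
move=> v12 xj; rewrite inE; apply: eval_ex => i.
rewrite eval_and (eval_near m (i := i) (j := j)) ?lt0b //.
by rewrite /update (negbTE v12).
Qed.
Arguments eval_core {x} m {v j}.

Lemma eval_cut x m :
  eval P x m cutE = (K * (budget P + 1 - g) <=
    \sum_(v in core (nearby 0 (rad x)) (fun u : 'I_n => 0 < m Sel u)) m Price v).
Proof.
apply: eval_le_congr.
  by rewrite (eval_sum (F := fun=> budget P + 1 - g)) // sum_nat_const card_ord.
rewrite [RHS]big_mkcond; apply: eval_sum => v.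
by rewrite eval_when (eval_core m (j := v)) // lt0b.
Qed.

Section Raising.
Variables (p : nat) (Y : 'I_n -> nat) (m : memory).
Hypothesis massP : forall u : 'I_n, m Mass u = mass (nearby 0 p) Y u.

Definition violated (c : 'I_g) : bool :=
  \sum_(u in color_set c) minn K (mass (nearby 0 p) Y u) + K <= K * dem c.

Lemma eval_viol x (l : nat) (c : 'I_g) : [&& l != 20, l != 16 & l != 19] -> x l = c ->
  eval P x m (violE l) = violated c.
Proof.
case/and3P => l20 l16 l19 xl; apply: eval_le_congr; last first.
  rewrite (eval_sum (F := fun=> dem c)) ?sum_nat_const ?card_ord // => i.
  by apply: eval_dem => //; rewrite /update (negbTE l19).
apply: eval_add_congr => //; rewrite [RHS]big_mkcond; apply: eval_sum => u.
rewrite eval_when (eval_col m (i := c) (j := u)) //; last by rewrite /update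
  (negbTE l16).
rewrite inE; case: ifP => // _.
by rewrite -[LHS]/(if m Mass u <= K then m Mass u else K) massP; case: leqP; lia.
Qed.
Arguments eval_viol {x l c}.

Lemma eval_raise x (v : nat) (j : 'I_n) : [&& v != 12 & v != 13] -> x v = j ->
  rad x = p ->
  eval P x m (raiseE v) =
  raise (nearby 0 p) color_set K violated (mass (nearby 0 p) Y) j.
Proof.
case/andP => v12 v13 xj xp; rewrite /raise [RHS]big_mkcond; apply: eval_sum => c.
rewrite eval_when (eval_viol (c := c)) // lt0b; case: ifP => // _.
rewrite [RHS]big_mkcond; apply: eval_sum => u.
rewrite eval_when; pose x' : nat -> nat := update (update x 13 c) 12 u; rewrite -/x'.
have -> : 0 < eval P x' m (EAnd (colE 13 12) (ELt (ld Mass 12) (EBound Codes))) =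
    (u \in color_set c) && (mass (nearby 0 p) Y u < K).
  rewrite eval_and (eval_col m (i := c) (j := u)) // eval_lt !lt0b inE.
  by rewrite -massP.
case: ifP => // _; rewrite (eval_near m (i := u) (j := j)) //; first by rewrite -xp.
by rewrite /x' /update (negbTE v12) (negbTE v13).
Qed.
Arguments eval_raise {x v j}.

End Raising.

Lemma eval_valid x m :
  eval P x m validE =
  valid (nearby 2 (rad x)) color_set dem (budget P) [set u : 'I_n | 0 < m Cand u].
Proof.
apply: eval_and_congr.
  apply: eval_le_congr => //; rewrite -sum1_card big_mkcond; apply: eval_sum => u.
  by rewrite eval_le inE; case: (0 < _).
rewrite (eval_all (b := Colors) (F := fun l => dem l <= #|[set u in color_set l
  | [exists c,
    (c \in [set u : 'I_n | 0 < m Cand u]) && nearby 2 (rad x) c u]]|)) //.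
move=> l; apply: eval_le_congr; first exact: eval_dem.
rewrite -sum1_card big_mkcond; apply: eval_sum => u.
rewrite eval_and (eval_col m (i := l) (j := u)) //.
rewrite (eval_ex (b := Points) (F := fun c => (c \in [set u : 'I_n | 0 < m Cand
  u]) && nearby 2 (rad x) c u)).
  by rewrite lt0b !inE; case: (_ && _).
by move=> c; rewrite eval_and (eval_near m (i := c) (j := u)) // lt0b inE.
Qed.

Lemma eval_base x m e F : eval P x m e = F -> (forall i : 'I_n, eval P (update
  x 20 i) m e = F) ->
  eval P x m (EBase e) = F * n.+1.
Proof.
move=> eF eF' /=; rewrite eF (eq_bigr (fun=> F)) //.
by rewrite sum_nat_const card_ord mulnS mulnC addnC.
Qed.

Lemma eval_quot x m : m Code 0 < K -> eval P x m quotE = m Code 0 %/ n.+1.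
Proof.
move=> cK; rewrite (eval_sum (F := fun j => (j < m Code 0 %/ n.+1) : nat)); last first.
  move=> j; rewrite eval_le (@eval_base _ _ _ j.+1) /= ?addn1 // => [|i]; last
    by rewrite addn1.
  by rewrite -leq_divRL.
have le : m Code 0 %/ n.+1 <= K by apply: leq_trans (leq_div _ _) (ltnW cK).
transitivity (\sum_(j < m Code 0 %/ n.+1) 1); last by rewrite sum1_card card_ord.
rewrite (big_ord_widen K (fun=> 1) le) [RHS]big_mkcond.
by apply: eq_bigr => j _; case: ifP.
Qed.

Lemma eval_rem x m : m Code 0 < K -> eval P x m remE = m Code 0 %% n.+1.
Proof.
move=> cK; rewrite -[LHS]/(m Code 0 - eval P x m (EBase quotE)).
rewrite (@eval_base _ _ _ (m Code 0 %/ n.+1)) ?eval_quot // => [|i]; last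
  exact: eval_quot.
by rewrite {1}(divn_eq (m Code 0) n.+1) addKn.
Qed.

End Expressions.

(** * Correctness of the search *)

Section Commands.
Variable P : params.
Notation n := (npts P).
Notation g := (ncol P).
Notation K := (ncode P).
Implicit Types (x : nat -> nat) (m : memory).
Hypothesis room : g + g * n <= K.

Lemma run_seq x c1 c2 m : run P x (CSeq c1 c2) m = run P x c2 (run P x c1 m).
Proof. by []. Qed.

Lemma eval_if x m e1 e2 e3 : eval P x m (EIf (ECst 1) e1 e2 e3) =
  if 0 < eval P x m e1 then eval P x m e2 else eval P x m e3.
Proof. by []. Qed.

Lemma run_store0 x a e m : run P x (store0 a e) m a 0 = eval P x m e.
Proof. by rewrite /= mem_set_eq /update. Qed.

Lemma run_fill_ord x v a e m (u : 'I_n) : ~~ reads Tmp e -> array_id a != 0 ->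
  run P x (fill a v Points e) m a u = eval P (update x v u) m e.
Proof. by move=> re a0; rewrite run_fill // ltn_ord. Qed.

(** Whether a point is selected depends only on better points, so after [k] rounds the equation
    holds at all points of rank below [k], and every rank is below [n]. *)
Lemma run_select x m (Y := fun v : 'I_n => m Price v) (p := rad P x)
    (m' := run P x select m) :
  (forall u : 'I_n, m' Mass u = mass (nearby 0 p) Y u) /\
  forall u : 'I_n, (0 < m' Sel u) =
    ~~ [exists v, [&& better (nearby 0 p) Y v u, nearby 2 p v u & 0 < m' Sel v]].
Proof.
pose F (X : pred 'I_n) u := ~~ [exists v, [&& better (nearby 0 p) Y v u, nearby
  2 p v u & X v]].
pose I k m' := (forall u : 'I_n, m' Mass u = mass (nearby 0 p) Y u) /\
  forall u : 'I_n, #|[set w | better (nearby 0 p) Y w u]| < k ->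
    (0 < m' Sel u) = F (fun v => 0 < m' Sel v) u.
suff [hM hS] : I n m'.
  by split=> // u; exact: (hS u (rank_lt _ _ _)).
rewrite /m' /select run_seq; apply: (run_for_inv (b := Points) (I := I)).
  split=> // u; rewrite run_fill_ord // (eval_mass _ (i := u)) //.
move=> k m1 kn [hM hS].
set m2 := run _ _ _ _.
have hM2 (u : 'I_n) : m2 Mass u = mass (nearby 0 p) Y u by rewrite /m2 run_frame // hM.
have hS2 (u : 'I_n) : (0 < m2 Sel u) = F (fun v => 0 < m1 Sel v) u.
  by rewrite /m2 run_fill_ord // (eval_sel hM (i := u)) ?lt0b.
split=> // u; rewrite ltnS => ru; rewrite hS2 /F; congr (~~ _).
apply: eq_existsb => v; case vu: (better _ _ v u) => //=; congr (_ && _).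
by rewrite hS2; apply: hS; apply: leq_trans ru; exact: better_lt_rank.
Qed.

(** Each round removes the least significant digit of the code and marks the point it names. *)
Lemma run_guess x m (m' := run P x guess m) : x 5 < K ->
  forall u : 'I_n, 0 < m' Guess u <->
    exists2 j, j < g & x 5 %/ n.+1 ^ j %% n.+1 = u.
Proof.
move=> qK.
pose I k m' := m' Code 0 = x 5 %/ n.+1 ^ k /\
  forall u : 'I_n, 0 < m' Guess u <-> exists2 j, j < k & x 5 %/ n.+1 ^ j %% n.+1 = u.
suff [_ h] : I g m' by [].
rewrite /m' /guess run_seq run_seq; apply: (run_for_inv (b := Colors) (I := I)).
  split; first by rewrite run_frame // run_store0 /= expn0 divn1.
  by move=> u; rewrite run_fill_ord //=; split=> // -[].
move=> k m1 kg [hC hG]; rewrite run_seq; set x' := update x 13 k.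
set m2 := run P x' (fill _ _ _ _) m1.
have C1 : m1 Code 0 < K by rewrite hC; apply: leq_ltn_trans (leq_div _ _) qK.
have C2 : m2 Code 0 = m1 Code 0 by rewrite /m2 run_frame.
split; first by rewrite run_store0 eval_quot ?C2 // hC -divnMA expnSr.
move=> u; rewrite run_frame // /m2 run_fill_ord // eval_or lt0b eval_and !eval_le.
rewrite !eval_rem // !lt0b /= /update /= -/(update x 13 k) -eqn_leq hC.
split=> [/orP[/hG[j jk e]|/eqP e]|[j]].
- by exists j => //; exact: leqW.
- by exists k.
- by rewrite ltnS leq_eqVlt => /predU1P[->|jk] e; apply/orP; [right; apply/eqP
    | left; apply/hG; exists j].
Qed.

(** The members of [G] are the digits, padded with [n] to length [g]. *)
Lemma run_guess_exists (G : {set 'I_n}) : #|G| <= g -> n.+1 ^ g <= K ->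
  exists2 q, q < K & forall x m, x 5 = q -> guessed P (run P x guess m) = G.
Proof.
move=> Gg leK; pose s := [seq val u | u <- enum G] ++ nseq (g - #|G|) n.
have sz : size s = g by rewrite size_cat size_map size_nseq -cardE subnKC.
have [|q qlt qE] := @digits_exist n.+1 s.
  rewrite all_cat all_nseq ltnSn orbT andbT all_map; apply/allP => u _ /=.
  exact: leqW (ltn_ord u).
have qK : q < K by rewrite sz in qlt; exact: leq_trans leK.
exists q => // x m xq; apply/setP => u; rewrite inE.
have memE : (val u \in s) = (u \in G).
  rewrite mem_cat mem_nseq [val u == n](ltn_eqF (ltn_ord u)) andbF orbF.
  by rewrite (mem_map val_inj) mem_enum.
have hG : x 5 < K by rewrite xq.
rewrite -memE; apply/idP/(nthP 0) => [/(run_guess m hG u)[j jg e]|[j js e]].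
  by exists j; rewrite ?sz // -qE ?sz // -xq.
by apply/(run_guess m hG u); exists j; rewrite -?sz // xq qE.
Qed.

Section Family.
Variables (p : nat) (Y : 'I_n -> nat) (m : memory).
Hypothesis massP : forall u : 'I_n, m Mass u = mass (nearby 0 p) Y u.

(** Colors are taken as naturals, with default 0 out of range, to fit [digits_value]. *)
Definition covered (mode : nat) (s : 'I_n) (l : nat) : nat :=
  oapp (fun c : 'I_g =>
    #|(cluster p Y m mode s :\: ball1 (nearby 0 p) (guessed P m)) :&: color_set c|)
    0 (insub l).

Definition weight_of mode s := digits_value n.+1 1 (covered mode s) g.

Lemma run_weigh x : rad P x = p ->
  forall s : 'I_n, run P x weigh m Weight s = weight_of (x 4) s.
Proof.
move=> xp; pose I k m' := [/\ m' Mass = m Mass, m' Sel = m Sel, m' Guess = m Guess &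
  forall s : 'I_n, m' Weight s = digits_value n.+1 1 (covered (x 4) s) k].
suff [_ _ _ h] : I g (run P x weigh m) by [].
rewrite /weigh run_seq; apply: (run_for_inv (b := Colors) (I := I)).
  by split=> [|||s]; [exact: run_frame | exact: run_frame | exact: run_frame |
    rewrite run_fill_ord].
move=> k m1 kg [hM hS hG hW].
split=> [|||s]; [by rewrite run_frame | by rewrite run_frame | by rewrite run_frame | ].
rewrite run_fill_ord //; apply: eval_add_congr.
  by apply: eval_base => [|i]; exact: hW.
have massP1 (u : 'I_n) : m1 Mass u = mass (nearby 0 p) Y u by rewrite hM.
rewrite (eval_cover room massP1 (i := s) (c := Ordinal kg)) // /covered.
by rewrite (insubT (fun l => l < g) kg) /= /cluster /guessed hS hG.
Qed.

End Family.

Definition witness m (c : nat) : {set 'I_n} := [set u : 'I_n | 0 < m Wit (n * c + u)].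

(** The dynamic program finds some set with the same total weight as [A], not [A] itself. Since sums
    of weights have no carries, such a set has as many clusters and covers as many points of each
    color. *)
Lemma run_subset_sums x m (w := fun u : 'I_n => m Weight u) (A : {set 'I_n}) :
  let c := \sum_(u in A) w u in
  c < K -> \sum_(u in witness (run P x subset_sums m) c) w u = c.
Proof.
pose I k m' := [/\ m' Weight = m Weight,
  forall c, c < K -> 0 < m' Reach c ->
    \sum_(u in witness m' c) w u = c /\ forall u, u \in witness m' c -> u < k &
  forall B : {set 'I_n}, (forall u, u \in B -> u < k) ->
    \sum_(u in B) w u < K -> 0 < m' Reach (\sum_(u in B) w u)].
suff [_ h1 h2] : I n (run P x subset_sums m).
  by move=> c cK; have [] := h1 c cK (h2 A (fun u _ => ltn_ord u) cK).
rewrite /subset_sums run_seq run_seq; apply: (run_for_inv (b := Points) (I := I)).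
  set m1 := run P x (fill Reach _ _ _) m; set m2 := run P x (fill2 _ _ _ _ _) m1.
  have R2 : m2 Reach = m1 Reach by rewrite /m2 run_frame.
  have W2 c : c < K -> witness m2 c = set0.
    by move=> cK; apply/setP => u; rewrite !inE /m2 run_fill2.
  have R1 c : c < K -> m1 Reach c = (c == 0).
    by move=> cK; rewrite /m1 run_fill // cK eval_not /= /update /= -leqNgt leqn0.
  split=> [|c cK|B hB BK].
  - by rewrite /m2 run_frame // /m1 run_frame.
  - by rewrite R2 R1 // W2 // lt0b => /eqP ->; rewrite big_set0; split=> // u;
      rewrite inE.
  - suff -> : B = set0 by rewrite big_set0 R2 R1 //; rewrite /= (leq_ltn_trans _ BK).
    by apply/setP => u; rewrite inE; apply/negP => /hB.
move=> k m1 kn [hW hR hB]; rewrite run_seq.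
set x' := update x 18 k; set m2 := run P x' (fill2 _ _ _ _ _) m1.
set m3 := run P x' _ m2; pose s := Ordinal kn.
pose ext c := (w s <= c) && (0 < m1 Reach (c - w s)).
have extE m' c u : m' Weight = m1 Weight -> m' Reach = m1 Reach ->
   (0 < eval P (update (update x' 6 c) 10 u) m' extendE) = ext c /\
   (0 < eval P (update x' 6 c) m' extendE) = ext c.
  by move=> eW eR; rewrite !eval_and !eval_le !lt0b /= /update /= eW eR hW.
have W2 : m2 Weight = m1 Weight by rewrite /m2 run_frame.
have R2 : m2 Reach = m1 Reach by rewrite /m2 run_frame.
have R3 c : c < K -> (0 < m3 Reach c) = ext c || (0 < m1 Reach c).
  move=> cK; rewrite /m3 run_fill // cK eval_or (extE _ _ 0 W2 R2).2 lt0b.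
  by rewrite [eval _ _ _ _]/= /update /= R2.
(* [Wit] is refilled before [Reach], so both decide by the old [Reach]; a row is replaced even if
   its sum was reachable before. *)
have Wit3 c : c < K -> witness m3 c =
   if ext c then s |: witness m1 (c - w s) else witness m1 c.
  move=> cK; apply/setP => u; rewrite inE /m3 run_frame // /m2 run_fill2 //.
  rewrite eval_if (extE m1 c u erefl erefl).1; case: ifP => _.
    rewrite eval_or lt0b eval_and !eval_le !lt0b !inE; congr (_ || _).
      by rewrite /= /update /= -val_eqE /= eqn_leq.
    rewrite /= /update /= (eq_bigr (fun=> c - w s)) => [|i _]; last by rewrite hW.
    by rewrite sum_nat_const card_ord.
  by rewrite inE -[eval _ _ _ _]/(m1 Wit (eval P (update (update x' 6 c) 10 u)
    m1 (pairE 6 10))) eval_pair.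
split.
- by rewrite /m3 run_frame // W2.
- move=> c cK; rewrite R3 // Wit3 //; case: ifP => [/andP[wc Rc] _|_ /= Rc].
    have [|e lt] := hR (c - w s) _ Rc; first by apply: leq_ltn_trans (leq_subr _ _) cK.
    split=> [|u]; last by rewrite !inE => /predU1P[-> //|uW]; rewrite ltnS ltnW
      // lt // inE.
    rewrite big_setU1 ?e /=; first exact: subnKC.
    (* The old witness contains only points below [k], so [s] is new. *)
    by apply/negP => /lt; rewrite ltnn.
  by have [e lt] := hR c cK Rc; split=> // u /lt; exact: leqW.
- move=> B ltB BK; rewrite R3 //; case: (boolP (s \in B)) => sB; last first.
    rewrite hB ?orbT // => u uB; have := ltB u uB; rewrite ltnS leq_eqVlt =>
      /predU1P[us|//].
    by move: sB; rewrite (_ : s = u) ?uB //; apply: val_inj.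
  have e : \sum_(u in B) w u - w s = \sum_(u in B :\ s) w u.
    by rewrite (big_setD1 s) //= addKn.
  have le : w s <= \sum_(u in B) w u by rewrite (big_setD1 s) //= leq_addr.
  rewrite /ext le e hB //.
    move=> u; rewrite !inE => /andP[us /ltB]; rewrite ltnS leq_eqVlt => /predU1P[e'|//].
    by case/eqP: us; apply: val_inj.
  by rewrite -e; apply: leq_ltn_trans (leq_subr _ _) BK.
Qed.

End Commands.

(** * The stored candidate: soundness and persistence *)

Section Search.
Variable P : params.
Notation n := (npts P).
Notation g := (ncol P).
Notation K := (ncode P).
Implicit Types (x : nat -> nat) (m : memory).
Hypothesis room : g + g * n <= K.

Definition valid_for (q : nat) (C : {set 'I_n}) : bool :=
  valid (nearby 2 q) (@color_set P) (@dem P) (budget P) C.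

Definition candidate m c : {set 'I_n} := guessed P m :|: witness P m c.

Definition accepted x m : bool :=
  valid_for (rad P x) (candidate m (x 6)) &&
  ((m Found 0 == 0) || dle P 0 (m Best 0) (rad P x)).

Lemma run_attempt x m (m' := run P x attempt m) (a := accepted x m) :
  [/\ m' Found 0 = a || (0 < m Found 0),
      m' Best 0 = if a then rad P x else m Best 0 &
      [set u : 'I_n | 0 < m' Out u] =
        if a then candidate m (x 6) else [set u : 'I_n | 0 < m Out u]].
Proof.
rewrite /m' /attempt run_seq run_seq run_seq run_seq.
set m1 := run P x (fill Cand _ _ _) m.
set m2 := run P x (store0 Ok _) m1.
set m3 := run P x (fill Out _ _ _) m2.
set m4 := run P x (store0 Best _) m3.
have C1 : [set u : 'I_n | 0 < m1 Cand u] = candidate m (x 6).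
  apply/setP => u; rewrite !inE /m1 run_fill_ord // eval_or lt0b; congr (_ || _).
  rewrite -[eval _ _ _ (ELoad _ _)]/(m Wit (eval P (update x 10 u) m (pairE 6 10))).
  by rewrite eval_pair.
have F1 : m1 Found = m Found by rewrite /m1 run_frame.
have B1 : m1 Best = m Best by rewrite /m1 run_frame.
have A2 : m2 Ok 0 = a.
  rewrite /m2 run_store0; apply: eval_and_congr; first by rewrite eval_valid // C1.
  rewrite eval_or eval_not; congr (nat_of_bool (_ || _)).
    by rewrite lt0b /= F1 -leqNgt leqn0.
  rewrite -[eval _ _ _ _]/(nat_of_bool (dle P 0 (m1 Best 0) (eval P x m1 radE))).
  by rewrite lt0b B1 eval_rad.
have A3 : m3 Ok 0 = a by rewrite -A2 /m3 run_frame.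
have A4 : m4 Ok 0 = a by rewrite -A3 /m4 run_frame.
split.
- rewrite run_store0 eval_or -[eval _ _ _ _]/(m4 Ok 0) A4 lt0b.
  by rewrite -[eval _ _ _ _]/(m4 Found 0) /m4 run_frame // /m3 run_frame // /m2
    run_frame // F1.
- rewrite run_frame // /m4 run_store0 eval_if -[eval _ _ _ _]/(m3 Ok 0) A3 lt0b.
  by rewrite eval_rad -[eval _ _ _ _]/(m3 Best 0) /m3 run_frame // /m2 run_frame // B1.
- rewrite -C1; apply/setP => u; rewrite inE run_frame // /m4 run_frame //.
  rewrite /m3 run_fill_ord // eval_if -[eval _ _ _ (ld0 _)]/(m2 Ok 0) A2 lt0b.
  rewrite -[eval _ _ _ (ld Cand 10)]/(m2 Cand u) -[eval _ _ _ (ld Out 10)]/(m2 Out u).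
  rewrite /m2 !run_frame //; case: (a); rewrite inE // /m1 run_frame //.
Qed.

(** The empty set before any success bounds the number of returned centers also for instances
    without a solution. *)
Definition sound m : Prop :=
  if 0 < m Found 0 then
    exists u v : 'I_n, m Best 0 = n * u + v /\
      valid_for (m Best 0) [set u : 'I_n | 0 < m Out u]
  else [set u : 'I_n | 0 < m Out u] = set0.

Definition good q m : Prop := 0 < m Found 0 /\ dle P 0 q (m Best 0).

(** Both [sound] and [good q] are of this kind. After the initialization only [attempt] writes the
    three arrays, so such a property survives all the rest of the search. *)
Record preserved (Q : memory -> Prop) : Prop := Preserved {
  preserved_ext : forall m m', m' Found = m Found -> m' Best = m Best ->
    m' Out = m Out -> Q m -> Q m';
  preserved_attempt : forall x m, x 0 < n -> x 1 < n -> Q m -> Q (run P x attempt m)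
}.

Lemma sound_preserved : preserved sound.
Proof.
split=> [m m' eF eB eO|x m x0 x1]; first by rewrite /sound eF eB eO.
have [eF eB eO] := run_attempt x m; rewrite /sound eF eB eO.
case ac: (accepted x m); last by rewrite orFb lt0b.
move=> _; exists (Ordinal x0), (Ordinal x1); split=> //.
by case/andP: ac.
Qed.

Hypothesis dle_refl : forall q, dle P 0 q q.
Hypothesis dle_trans : forall a b c, dle P 0 a b -> dle P 0 b c -> dle P 0 a c.
Hypothesis dle_total : forall a b, dle P 0 a b || dle P 0 b a.

Lemma good_preserved q : preserved (good q).
Proof.
split=> [m m' eF eB eO|x m x0 x1 [F0 qB]]; first by rewrite /good eF eB.
have [eF eB _] := run_attempt x m; rewrite /good eF eB F0 orbT; split=> //.
case: ifP => // /andP[_]; rewrite (gtn_eqF F0) /=; exact: dle_trans.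
Qed.

(** If the valid candidate is rejected, the stored radius is smaller already, by totality. *)
Lemma attempt_good x m : valid_for (rad P x) (candidate m (x 6)) ->
  good (rad P x) (run P x attempt m).
Proof.
move=> v; have [eF eB _] := run_attempt x m; rewrite /good eF eB /accepted v /=.
have [//|F0] := posnP (m Found 0); case: ifP => //= nle; split=> //.
by have := dle_total (m Best 0) (rad P x); rewrite nle.
Qed.

Lemma preserved_for (Q : memory -> Prop) v b c x m :
  (forall i m', i < bval P b -> Q m' -> Q (run P (update x v i) c m')) ->
  Q m -> Q (run P x (CFor v b c) m).
Proof. by move=> h Qm; exact: (@run_for_inv P x v b c (fun=> Q)). Qed.

Lemma preserved_frame Q c x m : preserved Q ->
  [&& ~~ writes Found c, ~~ writes Best c & ~~ writes Out c] -> Q m -> Q (run P x c m).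
Proof.
by move=> pQ /and3P[h1 h2 h3]; apply: (preserved_ext pQ); rewrite run_frame.
Qed.

Lemma preserved_try Q x m : preserved Q -> x 0 < n -> x 1 < n -> Q m ->
  Q (run P x try_all m).
Proof.
move=> pQ x0 x1; apply: preserved_for => // i m1 _; apply: preserved_for => //
  j m2 _ Q2.
rewrite run_seq run_seq run_seq; apply: preserved_for => //.
  by move=> c m3 _; apply: preserved_attempt.
by do 3![apply: preserved_frame => //].
Qed.

Lemma preserved_iteration Q x m : preserved Q -> x 0 < n -> x 1 < n -> Q m ->
  Q (run P x (CSeq select (CSeq try_all adjust)) m).
Proof.
move=> pQ x0 x1 Qm; rewrite run_seq run_seq; apply: preserved_frame => //.
by apply: preserved_try => //; apply: preserved_frame.
Qed.

Lemma preserved_search_radius Q x m : preserved Q -> x 0 < n -> x 1 < n -> Q m ->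
  Q (run P x search_radius m).
Proof.
move=> pQ x0 x1 Qm; rewrite /search_radius run_seq.
apply: preserved_for => //; last exact: preserved_frame.
move=> i m1 _; apply: preserved_for => // j m2 _.
exact: preserved_iteration.
Qed.

Lemma run_adjust x m (p := rad P x) (Y := fun v : 'I_n => m Price v)
    (S := core (nearby 0 p) (fun u : 'I_n => 0 < m Sel u)) :
  (forall u : 'I_n, m Mass u = mass (nearby 0 p) Y u) ->
  forall v : 'I_n, run P x adjust m Price v =
    if K * (budget P + 1 - g) <= \sum_(v in S) Y v then Y v - (v \in S)
    else Y v + raise (nearby 0 p) (@color_set P) K (violated p Y) (mass (nearby
      0 p) Y) v.
Proof.
move=> hM v; rewrite run_fill_ord // eval_if eval_cut lt0b; case: ifP => _.
  rewrite -[LHS]/(m Price v - eval P (update x 10 v) m (coreE 10)).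
  by rewrite (eval_core m (j := v)).
rewrite -[LHS]/(m Price v + eval P (update x 10 v) m (raiseE 10)).
by rewrite (eval_raise room hM (j := v)).
Qed.

End Search.

(** * Progress of one iteration and success for a given radius *)

Section Iteration.
Variable P : params.
Notation n := (npts P).
Notation g := (ncol P).
Notation K := (ncode P).
Notation col := (@color_set P).
Implicit Types (x : nat -> nat) (m : memory).
Hypothesis n_gt1 : 1 < n.
Hypothesis g_gt0 : 0 < g.
(** One number bounds everything: the codes of [g] guessed points, the weights with their [g + 1]
    digits, the input addresses, and the quadratic terms [n] and [n ^ 3 * g] of the two perceptron
    steps. *)
Hypothesis KE : K = n.+1 ^ (g + 3).
Hypothesis dle_refl : forall q, dle P 0 q q.
Hypothesis dle_trans : forall a b c, dle P 0 a b -> dle P 0 b c -> dle P 0 a c.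
Hypothesis dle_total : forall a b, dle P 0 a b || dle P 0 b a.

Lemma g_le_exp : g <= n.+1 ^ g.
Proof. by apply: ltnW; apply: ltn_expl; rewrite ltnS ltnW. Qed.

Lemma room : g + g * n <= K.
Proof.
rewrite -mulnS KE expnD leq_mul ?g_le_exp //.
by rewrite -[leqLHS]expn1 leq_exp2l // ltnS ltnW.
Qed.

Lemma pow_le_code : n.+1 ^ g.+1 <= K.
Proof. by rewrite KE leq_exp2l; lia. Qed.

Lemma cube_le_code : n ^ 3 * g <= K.
Proof. by rewrite KE expnD mulnC leq_mul ?g_le_exp ?leq_exp2r. Qed.

Lemma n_le_code : n <= K.
Proof.
rewrite KE; apply: leq_trans (leqnSn n) _; rewrite -[leqLHS]expn1 leq_exp2l; lia.
Qed.

Section Radius.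
Variable p : nat.
Notation b1 := (@nearby P 0 p).
Notation b2 := (@nearby P 1 p).
Notation b4 := (@nearby P 2 p).
Hypothesis b1C : symmetric b1.
Hypothesis b2C : symmetric b2.
Hypothesis b4C : symmetric b4.
Hypothesis b1_refl : reflexive b1.
Hypothesis b1W : subrel b1 b2.
Hypothesis b2W : subrel b2 b4.
Hypothesis b1T : forall u v w, b1 u v -> b1 v w -> b2 u w.
Hypothesis b2T : forall u v w, b2 u v -> b2 v w -> b4 u w.

Section Selected.
Variables (Y : 'I_n -> nat) (m1 : memory).
Notation sel := (fun u : 'I_n => 0 < m1 Sel u).
Hypothesis massP : forall u : 'I_n, m1 Mass u = mass b1 Y u.
Hypothesis selP : forall u : 'I_n,
  (0 < m1 Sel u) = ~~ [exists v, [&& better b1 Y v u, b4 v u & 0 < m1 Sel v]].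

Lemma cluster_b4 mode s u : u \in cluster p Y m1 mode s -> b4 s u.
Proof.
rewrite /cluster; case: eqP => _; rewrite inE.
  by case/andP => /and3P[].
by case/andP => _ /b2W.
Qed.

Lemma cluster_disjoint mode s s' u :
  u \in cluster p Y m1 mode s -> u \in cluster p Y m1 mode s' -> s = s'.
Proof.
rewrite /cluster; case: eqP => _; rewrite !inE; first exact: owns_uniq.
by case/andP => hs su /andP[hs' s'u]; exact: (sel_disjoint b2C b4C b2T selP hs
  hs' su s'u).
Qed.

(** The loops reach the given mode, the code of [G] and the total weight of [A]; the witness of that
    weight serves as well as [A], and later attempts cannot spoil the result. *)
Lemma try_hit x (mode : nat) (G A : {set 'I_n}) : rad P x = p -> x 0 < n -> x 1 < n ->
  mode < n -> #|G| <= g -> #|G| + #|A| <= budget P ->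
  (forall l, dem l <= #|ball1 b1 G :&: col l| +
     \sum_(s in A) #|(cluster p Y m1 mode s :\: ball1 b1 G) :&: col l|) ->
  good P p (run P x try_all m1).
Proof.
move=> xp x0 x1 mode_n Gg GA cov.
have pgood := good_preserved room dle_trans p.
have [q qK qG] := run_guess_exists Gg (leq_trans (leq_pexp2l (ltn0Sn n) (leqnSn
  g)) pow_le_code).
pose I m := m Mass = m1 Mass /\ m Sel = m1 Sel.
apply: (run_for_hit (b := Points) (I := I) (i0 := mode)) => //.
- by move=> i m _ [eM eS]; split; rewrite run_frame.
- move=> i m _; apply: preserved_for => // j m2 _ Q2.
  rewrite run_seq run_seq run_seq; apply: preserved_for => //.
    by move=> c m3 _; apply: (preserved_attempt pgood).
  by do 3![apply: preserved_frame => //].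
move=> m Im; apply: (run_for_hit (b := Codes) (I := I) (i0 := q)) => //.
- by move=> i m' _ [eM eS]; split; rewrite run_frame.
- move=> i m' _ Q2; rewrite run_seq run_seq run_seq; apply: preserved_for => //.
    by move=> c m3 _; apply: (preserved_attempt pgood).
  by do 3![apply: preserved_frame => //].
move=> {Im}m [eM eS]; set x' := update _ 5 q; rewrite run_seq run_seq run_seq.
set m2 := run P x' guess m; set m3 := run P x' weigh m2.
set m4 := run P x' subset_sums m3.
have massP2 (u : 'I_n) : m2 Mass u = mass b1 Y u by rewrite /m2 run_frame // eM.
have G2 : guessed P m2 = G by exact: qG.
have W3 (s : 'I_n) : m3 Weight s = weight_of p Y m2 mode s.
  by rewrite /m3 (run_weigh room massP2).
have clE (s : 'I_n) : cluster p Y m2 mode s = cluster p Y m1 mode s.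
  by rewrite /cluster /m2 run_frame // eS.
pose V (s : 'I_n) (l : 'I_g) := (cluster p Y m1 mode s :\: ball1 b1 G) :&: col l.
have covE (s : 'I_n) (l : 'I_g) : covered p Y m2 mode s l = #|V s l|.
  by rewrite /covered valK /= clE G2.
have sumE (B : {set 'I_n}) : \sum_(s in B) m3 Weight s =
  digits_value n.+1 #|B| (fun l => \sum_(s in B) covered p Y m2 mode s l) g.
  under eq_bigr do rewrite W3 /weight_of.
  by rewrite digits_value_sum sum1_card.
(* Disjoint clusters cover at most [n] points in total, so no digit of a sum overflows. *)
have digit_lt (B : {set 'I_n}) l : l < g -> \sum_(s in B) covered p Y m2 mode s
  l < n.+1.
  move=> lg; under eq_bigr do rewrite (covE _ (Ordinal lg)).
  rewrite ltnS -[leqRHS]card_ord; apply: sum_card_disjoint => s s' u.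
  rewrite !inE => /andP[/andP[_ us] _] /andP[/andP[_ us'] _].
  exact: cluster_disjoint us us'.
pose c := \sum_(s in A) m3 Weight s.
have cK : c < K.
  rewrite /c sumE; apply: leq_trans (digits_value_lt _ (digit_lt A)) _.
  apply: leq_trans pow_le_code; rewrite expnS leq_mul2r ltnS -[X in _ <= X](card_ord n).
  by rewrite max_card orbT.
have eA : \sum_(u in witness P m4 c) m3 Weight u = c by exact: run_subset_sums cK.
(* Equal weights have equal digits: the same number of clusters and the same coverage of each
   color. *)
have [cardA sumA] : #|witness P m4 c| = #|A| /\ forall l, l < g ->
    \sum_(s in witness P m4 c) covered p Y m2 mode s l = \sum_(s in A) covered
      p Y m2 mode s l.
  by apply: (digits_value_inj (digit_lt _) (digit_lt _)); rewrite -!sumE eA.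
apply: (run_for_hit (b := Codes) (i0 := c)
  (I := fun m' => m' Guess = m4 Guess /\ m' Wit = m4 Wit)) => //.
- by move=> i m' _ [eG eW]; split; rewrite run_frame.
- by move=> i m' _; apply: (preserved_attempt pgood).
move=> m' [eG eW]; rewrite -xp.
apply: (attempt_good room dle_refl dle_total).
have -> : candidate P m' c = G :|: witness P m4 c.
  rewrite /candidate -G2; congr (_ :|: _); apply/setP => u; rewrite !inE ?eW //.
  by rewrite eG /m4 run_frame // /m3 run_frame.
rewrite [rad P _]xp; apply: (valid_union b1W b2W (W := cluster p Y m1 mode)).
- exact: cluster_b4.
- exact: cluster_disjoint.
- by rewrite cardA.
- move=> l; apply: leq_trans (cov l) _; rewrite leq_add2l.
  have := sumA l (ltn_ord l).
  by under eq_bigr do rewrite covE; under [in RHS]eq_bigr do rewrite covE; move=> ->.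
Qed.

End Selected.

Variable C : {set 'I_n}.
Hypothesis C_budget : #|C| <= budget P.
Hypothesis C_cover : forall l, dem l <= #|ball1 b1 C :&: col l|.

Definition progress (t : nat) m : Prop :=
  good P p m \/ (potential K C (fun v => m Price v) + (t * K)%:Z <= (K * K * n)%:Z)%R.

(** The cases of the outline are distinguished only in this proof; the program tries everything and
    then adjusts the prices. *)
Lemma iteration_progress x t m : rad P x = p -> x 0 < n -> x 1 < n ->
  progress t m -> progress t.+1 (run P x (CSeq select (CSeq try_all adjust)) m).
Proof.
move=> xp x0 x1; have pgood := good_preserved room dle_trans p.
case=> [gm|le_t]; first by left; exact: preserved_iteration.
rewrite run_seq run_seq.
set m1 := run P x select m; set m2 := run P x try_all m1.
have [massP selP] := @run_select P x m; rewrite -/m1 xp in massP selP.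
pose Y (v : 'I_n) := m Price v; rewrite -/Y in massP selP.
pose S := core b1 (fun u : 'I_n => 0 < m1 Sel u).
have hit mode (G A : {set 'I_n}) : mode < n -> #|G| <= g -> #|G| + #|A| <= budget P ->
    (forall l : 'I_g, dem l <= #|ball1 b1 G :&: col l| +
     \sum_(s in A) #|(cluster p Y m1 mode s :\: ball1 b1 G) :&: col l|) ->
    progress t.+1 (run P x adjust m2).
  move=> h1 h2 h3 h4; left; apply: preserved_frame => //.
  exact: (try_hit massP selP (mode := mode) xp x0 x1 h1 h2 h3 h4).
(* If fewer than [g] members of [C] can lie outside the core, mode 1 succeeds with these as the
   guess. *)
have [lt_b|le_b] := ltnP (budget P) (#|C :&: S| + g).
  have [G [A [h1 h2 h3]]] :=
    guess_success b2C b4C b1W b1T b2T selP C_budget C_cover lt_b.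
  exact: (hit 1 G A).
have P2 : m2 Price = m Price by rewrite /m2 run_frame // /m1 run_frame.
have massP2 (u : 'I_n) : m2 Mass u = mass (nearby 0 (rad P x)) (fun v => m2 Price v) u.
  by rewrite (_ : m2 Mass = m1 Mass) ?massP ?P2 ?xp // /m2 run_frame.
have adj := run_adjust room massP2.
have core2 : core (nearby 0 (rad P x)) (fun u : 'I_n => 0 < m2 Sel u) = S.
  by rewrite /S /m2 run_frame // xp.
rewrite core2 xp P2 -/Y in adj.
have potE Z : (forall v : 'I_n, run P x adjust m2 Price v = Z v) ->
    potential K C (fun v => run P x adjust m2 Price v) = potential K C Z.
  by move=> e; apply: eq_bigr => v _; rewrite e.
have dec Z : (forall v : 'I_n, run P x adjust m2 Price v = Z v) ->
    (potential K C Z <= potential K C Y - K%:Z)%R -> progress t.+1 (run P x adjust m2).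
  move=> e le_Z; right; rewrite (potE Z e); move: le_Z le_t; rewrite -/Y mulSn
    PoszD; lia.
(* Otherwise a cut, or failing that a raise for some violated color, lowers the potential by [K]. *)
case: (leqP (K * (budget P + 1 - g)) (\sum_(v in S) Y v)) adj => [cut|ncut] adj.
  apply: dec adj _; exact: potential_cut n_le_code le_b cut.
case: (pickP (violated p Y)) => [l vl|noviol].
  apply: dec adj _; apply: (potential_raise b1C cube_le_code (dem := @dem P)) => //.
  by exists l.
have K0 : 0 < K by rewrite KE expn_gt0.
(* When neither step applies, mode 0 succeeds with the empty guess. *)
have [|A [h1 h2]] := @rounding_success n g b1 b2 b4 col (@dem P) (budget P) K
  b2C b4C b1_refl b1W b2W b2T Y _ selP g_gt0 K0 ncut.
  by move=> l; have := noviol l; rewrite /violated => /negbT; rewrite -ltnNge.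
apply: (hit 0 set0 A); rewrite ?cards0 //; first exact: ltnW.
move=> l; apply: leq_trans (h2 l) _.
have -> : ball1 b1 set0 = set0.
  by apply/setP => u; rewrite !inE; apply/existsP => -[c]; rewrite inE.
rewrite set0I cards0 add0n; apply: leq_sum => s _.
by rewrite setD0 /cluster eqxx.
Qed.

(* The potential cannot decrease [K ^ 2] times by [K]. *)
Lemma search_radius_good x m : rad P x = p -> x 0 < n -> x 1 < n ->
  good P p (run P x search_radius m).
Proof.
move=> xp x0 x1; have pgood := good_preserved room dle_trans p.
rewrite /search_radius run_seq; set m0 := run P x (fill _ _ _ _) m.
have I0 : progress 0 m0.
  right; rewrite mul0n addr0; apply: le_trans (potential0 K C).
  rewrite le_eqVlt; apply/orP; left; apply/eqP; apply: eq_bigr => v _.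
  by rewrite /m0 run_fill_ord.
set body := CSeq select (CSeq try_all adjust).
have hS i m' : i < K -> progress (i * K) m' ->
    progress (i.+1 * K) (run P (update x 2 i) (CFor 3 Codes body) m').
  move=> iK Im; rewrite mulSn addnC.
  pose I j m'' := progress (i * K + j) m''.
  have h0 : I 0 m' by rewrite /I addn0.
  apply: (run_for_inv (b := Codes) (I := I) h0) => j m1 jK.
  by rewrite /I addnS; exact: iteration_progress.
have [//|pot] := run_for_inv (b := Codes) (I := fun i m' => progress (i * K) m') I0 hS.
exfalso; move: pot; have := potential_ge0 K C (fun v => run P x (CFor 2 Codes
  (CFor 3 Codes body)) m0 Price v).
have : K * K * n < K * K * K.
  have nK : n < K.
    rewrite KE; apply: (@leq_trans (n.+1 ^ 1)); first by rewrite expn1.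
    by rewrite leq_exp2l; lia.
  by rewrite ltn_mul2l nK muln_gt0 (leq_ltn_trans (leq0n n) nK).
rewrite [bval _ _]/=; lia.
Qed.

End Radius.
End Iteration.

(** * Polynomial bounds on the cost *)

Definition polynomially_bounded (f : nat -> nat) : Prop :=
  exists C D, forall M, f M <= C * M.+1 ^ D.

Lemma polynomially_bounded_cst c : polynomially_bounded (fun=> c).
Proof. by exists c, 0 => M; rewrite muln1. Qed.

Lemma polynomially_bounded_id : polynomially_bounded id.
Proof. by exists 1, 1 => M; rewrite mul1n expn1. Qed.

Lemma polynomially_bounded_add f h : polynomially_bounded f ->
  polynomially_bounded h -> polynomially_bounded (fun M => f M + h M).
Proof.
move=> [C [D le_f]] [C' [D' le_h]]; exists (C + C'), (D + D') => M.
rewrite mulnDl leq_add //; apply: leq_trans (le_f M) _ || apply: leq_trans (le_h M) _;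
  by rewrite leq_mul // leq_pexp2l // ?leq_addr ?leq_addl.
Qed.

Lemma polynomially_bounded_mul f h : polynomially_bounded f ->
  polynomially_bounded h -> polynomially_bounded (fun M => f M * h M).
Proof.
move=> [C [D le_f]] [C' [D' le_h]]; exists (C * C'), (D + D') => M.
by rewrite expnD mulnACA leq_mul.
Qed.

Lemma ecost_poly e : polynomially_bounded (fun M => ecost M e).
Proof.
elim: e => [v|c| |b|e1 IH1 e2 IH2|e1 IH1 e2 IH2|a e1 IH1|e1 IH1
  |e1 IH1 e2 IH2 e3 IH3 e4 IH4|c e1 IH1 e2 IH2|v b e1 IH1] /=;
  do ?[exact: polynomially_bounded_cst | exact: polynomially_bounded_id | assumption
    | apply: polynomially_bounded_add | apply: polynomially_bounded_mul].
Qed.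

Lemma ccost_poly c : polynomially_bounded (fun M => ccost M c).
Proof.
elim: c => [a e1 e2|c1 IH1 c2 IH2|v b c1 IH1] /=;
  do ?[exact: polynomially_bounded_cst | exact: polynomially_bounded_id | assumption
    | exact: ecost_poly
    | apply: polynomially_bounded_add | apply: polynomially_bounded_mul].
Qed.

(** * The search over all radii *)

Section SearchAll.
Variable P : params.
Notation n := (npts P).
Notation g := (ncol P).
Notation K := (ncode P).
Hypothesis n_gt1 : 1 < n.
Hypothesis g_gt0 : 0 < g.
Hypothesis KE : K = n.+1 ^ (g + 3).
Hypothesis dle_refl : forall q, dle P 0 q q.
Hypothesis dle_trans : forall a b c, dle P 0 a b -> dle P 0 b c -> dle P 0 a c.
Hypothesis dle_total : forall a b, dle P 0 a b || dle P 0 b a.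

Lemma search_sound x m : sound P (run P x search m).
Proof.
have r := room n_gt1 KE; rewrite /search run_seq run_seq.
have ps := sound_preserved r.
apply: preserved_for => // [i m1 i_n|].
  apply: preserved_for => // j m2 j_n; exact: preserved_search_radius.
rewrite /sound run_frame // run_store0 [0 < _]/=.
by apply/setP => u; rewrite !inE run_fill_ord.
Qed.

Lemma search_good x m (u v : 'I_n) (p := n * u + v) (C : {set 'I_n}) :
  symmetric (@nearby P 0 p) -> symmetric (@nearby P 1 p) -> symmetric (@nearby P 2 p) ->
  reflexive (@nearby P 0 p) ->
  subrel (@nearby P 0 p) (@nearby P 1 p) -> subrel (@nearby P 1 p) (@nearby P 2 p) ->
  (forall u v w, @nearby P 0 p u v -> @nearby P 0 p v w -> @nearby P 1 p u w) ->
  (forall u v w, @nearby P 1 p u v -> @nearby P 1 p v w -> @nearby P 2 p u w) ->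
  #|C| <= budget P ->
  (forall l, dem l <= #|ball1 (@nearby P 0 p) C :&: @color_set P l|) ->
  good P p (run P x search m).
Proof.
move=> b1C b2C b4C b1r b1W b2W b1T b2T C_k cov; have r := room n_gt1 KE.
have pgood := good_preserved r dle_trans p.
rewrite /search run_seq run_seq.
apply: (run_for_hit (b := Points) (I := fun=> True) (i0 := u)) => // [i m1 i_n|m1 _].
  apply: preserved_for => // j m2 j_n; exact: preserved_search_radius.
apply: (run_for_hit (b := Points) (I := fun=> True) (i0 := v)) => // [j m2 j_n|m2 _].
  by apply: preserved_search_radius => //; exact: ltn_ord.
by apply: (search_radius_good n_gt1 g_gt0 KE dle_refl dle_trans dle_total
  b1C b2C b4C b1r b1W b2W b1T b2T C_k cov) => //; exact: ltn_ord.
Qed.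

End SearchAll.

(** * The complete machine program *)

Definition times_base : program :=
  Seq (Do (NAdd (treg 1) (treg 0) 5))
      (loop 0 Points 4 (Do (NAdd (treg 0) (treg 0) (treg 1)))).

(** Three multiplications by [n + 1] and one for each color leave [(n + 1) ^ (g + 3)] in register 3.
    The loop over colors uses temporaries 2 and 3, which [times_base] avoids. *)
Definition compute_codes : program :=
  Seq (Do (NConst (treg 0) 1))
  (Seq times_base (Seq times_base (Seq times_base
  (Seq (loop 1 Colors 2 times_base) (Do (NAdd 3 (treg 0) 5)))))).

Definition write_out : program :=
  loop 0 Points 0
    (Seq (comp 2 (ELoad Out (EVar 0))) (Do (NStore (vreg 0) (treg 2)))).

(* The time bound is constant when there is at most one point, whatever the
   number of colors, so that case needs a branch of its own. *)
Definition algorithm : program :=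
  Seq (Do (NConst 4 1))
    (If (NLe 0 4)
       (Seq (Do (NConst 7 0)) (Do (NStore 7 4)))
       (Seq compute_codes (Seq (ccomp 0 search) write_out))).

Definition times_base_cost (M : nat) : nat := 1 + (M * 5 + 6).

Definition algorithm_cost (M : nat) : nat :=
  2 + (1 + (times_base_cost M + (times_base_cost M + (times_base_cost M +
    ((M * (times_base_cost M + 4) + 6) + 1))))) +
  (ccost M search + (M * (ecost M (ELoad Out (EVar 0)) + 1 + 4) + 6)).

Lemma algorithm_cost_poly : polynomially_bounded algorithm_cost.
Proof.
rewrite /algorithm_cost /times_base_cost;
  do ?[exact: polynomially_bounded_cst | exact: polynomially_bounded_id
    | exact: ecost_poly | exact: ccost_poly
    | apply: polynomially_bounded_add | apply: polynomially_bounded_mul].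
Qed.

(** * Execution and running time *)

Section Machine.
Variables (R : realType) (d : nat -> R).
Implicit Types (P : params) (x : nat -> nat) (m : memory) (s : state R).

Lemma times_base_ok P x m s : repr d P x m s ->
  achieves times_base s (times_base_cost (npts P)) (fun s' =>
    [/\ repr d P x m s', narr s' = narr s,
        nreg s' (treg 0) = nreg s (treg 0) * (npts P).+1,
        nreg s' (treg 2) = nreg s (treg 2) & nreg s' (treg 3) = nreg s (treg 3)]).
Proof.
move=> rs; set a := nreg s (treg 0); set s1 := set_nreg s (treg 1) a.
apply: (achieves_seq (Q1 := eq s1)).
  by apply: achieves_do; rewrite run_instrE (repr_zero rs) addn0.
move=> _ <-.
pose H i s' := [/\ narr s' = narr s, nreg s' (treg 0) = a + i * a,
  nreg s' (treg 1) = a, nreg s' (treg 2) = nreg s (treg 2)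
  & nreg s' (treg 3) = nreg s (treg 3)].
apply: achieves_weaken
  (loop_ok (d := d) (P := P) (x := x) (io := fun=> inp P) (m := fun=> m) (H :=
    H) (T := 1) _ _ _ _) _ _.
- by move=> i s2 s3 k23 e [h1 h2 h3 h4 h5]; split; rewrite ?e ?k23.
- move=> i s2 iB; rewrite set_inpE => r2 [h1 h2 h3 h4 h5].
  apply: achieves_do; rewrite run_instrE; split.
  + exact: repr_temp.
  + split=> //; rewrite /= /update !regE /= ?h2 ?h3 //; lia.
  + by rewrite /= /update !regE.
  + by rewrite /= /update !regE.
- by rewrite set_inpE; exact: repr_temp.
- by split=> //; rewrite /= /update !regE /= ?addn0.
- by rewrite /times_base_cost.
- move=> s'; rewrite set_inpE => -[r' [h1 h2 h3 h4 h5]]; split=> //.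
  by rewrite h2 /= mulnS [a * _]mulnC.
Qed.

(** While register 3 is 0 no cell counts as input. Afterwards the same cells are read anew: those
    below [K] as input, those above as arrays with whatever content they have. *)
Lemma compute_codes_ok P x m s M (K := (npts P).+1 ^ (ncol P + 3)) :
  npts P <= M -> ncol P <= M -> ncode P = 0 -> repr d P x m s ->
  achieves compute_codes s
    (1 + (times_base_cost M + (times_base_cost M + (times_base_cost M +
    ((M * (times_base_cost M + 4) + 6) + 1))))) (fun s' =>
  repr d (Params (npts P) (ncol P) (budget P) K (narr s) (dle P)) x
    (fun a i => narr s (K + (16 * i + array_id a))) s').
Proof.
move=> nM gM K0 rs; set b := (npts P).+1.
have le_b : times_base_cost (npts P) <= times_base_cost M.
  by rewrite /times_base_cost; lia.
have step s1 : repr d P x m s1 -> achieves times_base s1 (times_base_cost M) (fun s' =>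
    [/\ repr d P x m s', narr s' = narr s1,
        nreg s' (treg 0) = nreg s1 (treg 0) * b,
        nreg s' (treg 2) = nreg s1 (treg 2) & nreg s' (treg 3) = nreg s1 (treg 3)]).
  by move=> r1; apply: achieves_weaken (times_base_ok r1) le_b _.
apply: (achieves_seq (Q1 := eq (set_nreg s (treg 0) 1))).
  by apply: achieves_do; rewrite run_instrE.
move=> _ <-; have r0 := repr_temp 0 1 rs.
apply: achieves_seq (step _ r0) _ => s1 [r1 a1 e1 _ _].
apply: achieves_seq (step _ r1) _ => s2 [r2 a2 e2 _ _].
apply: achieves_seq (step _ r2) _ => s3 [r3 a3 e3 _ _].
pose H i s' := narr s' = narr s /\ nreg s' (treg 0) = b ^ (i + 3).
apply: (achieves_seq (Q1 := fun s' => repr d P x m s' /\ H (ncol P) s')).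
  apply: achieves_weaken
    (loop_ok (d := d) (P := P) (x := x) (io := fun=> inp P) (m := fun=> m) (H
      := H) (T := times_base_cost M) _ _ _ _) _ _.
  - by move=> i s4 s5 k45 e [h1 h2]; split; rewrite ?e ?k45.
  - move=> i s4 iB; rewrite set_inpE => r4 [h1 h2].
    apply: achieves_weaken (times_base_ok r4) le_b _ => s5 [r5 a5 e5 f5 g5].
    split=> //.
    by split; [rewrite a5 | rewrite e5 h2 -expnSr].
  - by rewrite set_inpE.
  - split; first by rewrite a3 a2 a1.
    by rewrite e3 e2 e1 /= /update !regE mul1n add0n !expnS expn0 muln1 mulnA.
  - by rewrite leq_add2r leq_mul2r gM orbT.
  - by move=> s'; rewrite set_inpE.
move=> s4 [r4 [a4 e4]]; apply: achieves_do.
rewrite run_instrE (repr_zero r4) addn0 e4.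
case: r4 => *; split=> //=; rewrite ?a4 //.
by move=> v; rewrite /update; case: eqP => // h; move: h; rewrite /vreg; lia.
Qed.

(** After [i] rounds the first [i] input cells are overwritten; [npts P <= ncode P] keeps these
    writes away from [Out] itself. *)
Lemma write_out_ok P x m s M : (forall b, bval P b <= M) -> npts P <= ncode P ->
  repr d P x m s ->
  achieves write_out s (M * (ecost M (ELoad Out (EVar 0)) + 1 + 4) + 6) (fun s' =>
    forall i, i < npts P -> narr s' i = m Out i).
Proof.
move=> leM nK rs; pose io i a := if a < i then m Out a else inp P a.
apply: achieves_weaken
  (loop_ok (d := d) (P := P) (x := x) (io := io) (m := fun=> m) (H := fun _ _ => True)
    (T := ecost M (ELoad Out (EVar 0)) + 1) _ _ _ _) _ _ => //.
- move=> i s1 iB r1 _.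
  have leM1 b : bval (set_inp P (io i)) b <= M by rewrite bval_set_inp.
  apply: achieves_seq (comp_ok leM1 _ 2 r1) _ => s2 [r2 k2 e2].
  apply: achieves_do; rewrite run_storeE; split=> //=; try exact: k2.
  rewrite (repr_var r2) e2 /= /update /=; case: r2 => dl h0 h1 h2 h3 h4 h5 hv hi hm hd.
  split=> //= [a aK|a j]; rewrite /update.
    rewrite hi // /io /=; case: eqP => [->|ne]; first by rewrite leqnn.
    by rewrite ltnS [a <= i]leq_eqVlt; case: eqP.
  rewrite -hm /=; case: eqP => // e; move: iB e nK => /=; lia.
- by rewrite -{1}(set_inpE P) in rs; exact: rs.
- by rewrite leq_add2r leq_mul2r leM orbT.
- move=> s' [r' _] i i_n; rewrite (repr_inp r') /=; last exact: leq_trans nK.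
  by rewrite /io i_n.
Qed.

End Machine.

Local Open Scope ring_scope.

Import topology_theory.metric_structure.

(** * The approximation guarantee *)

Section Instance.
Variables (R : realType) (I : instance R).
Notation n := #|points I|.
Notation g := (ncolors I).
Implicit Types (u v : 'I_n) (l : 'I_g).

Lemma nth_orE (T : Type) k (x : T) (f : 'I_k -> T) (i : 'I_k) : nth_or x f i = f i.
Proof. by rewrite /nth_or valK. Qed.

Lemma input_dist u v :
  rarr (input I) (n * u + v)%N = mdist (enum_val u : points I) (enum_val v).
Proof.
have n0 : (0 < n)%N by apply: leq_ltn_trans (ltn_ord u).
rewrite /= mulnC divnMDl // modnMDl divn_small // modn_small // addn0.
by rewrite nth_orE nth_orE.
Qed.

Lemma input_demand l : narr (input I) l = demand l.
Proof. by rewrite /= ltn_ord nth_orE. Qed.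

Lemma input_color l u :
  narr (input I) (g + (n * l + u))%N = ((enum_val u : points I) \in color l).
Proof.
have n0 : (0 < n)%N by apply: leq_ltn_trans (ltn_ord u).
rewrite /= ltnNge leq_addr /= addKn mulnC divnMDl // modnMDl divn_small //
  modn_small //.
by rewrite addn0 nth_orE nth_orE.
Qed.

Definition params_of : params :=
  Params n g (ncenters I) (n.+1 ^ (g + 3)) (narr (input I))
    (fun c a b => rarr (input I) b <= rarr (input I) a *+ 2 ^ c).
Notation P := params_of.

Lemma nearbyE c p u v : @nearby P c p u v =
  (mdist (enum_val u : points I) (enum_val v) <= rarr (input I) p *+ 2 ^ c).
Proof. by rewrite /nearby /= -input_dist. Qed.

Lemma nearby_sym c p : symmetric (@nearby P c p).
Proof. by move=> u v; rewrite !nearbyE metric_sym. Qed.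

Lemma input_dist_ge0 u v : 0 <= rarr (input I) (n * u + v)%N.
Proof. by rewrite input_dist mdist_ge0. Qed.

Section Pair.
Variables u0 v0 : 'I_n.
Notation p := (n * u0 + v0)%N.

Lemma nearby_refl : reflexive (@nearby P 0 p).
Proof. by move=> u; rewrite nearbyE mdistxx mulrn_wge0 // input_dist_ge0. Qed.

Lemma nearby_weaken c : subrel (@nearby P c p) (@nearby P c.+1 p).
Proof.
move=> u v; rewrite !nearbyE => h; apply: le_trans h _.
by rewrite -[leLHS]mulr_natr -[leRHS]mulr_natr ler_wpM2l ?input_dist_ge0
  ?ler_nat ?leq_exp2l.
Qed.

Lemma nearby_trans c u v w :
  @nearby P c p u v -> @nearby P c p v w -> @nearby P c.+1 p u w.
Proof.
rewrite !nearbyE => uv vw; apply: le_trans (metric_triangle _ (enum_val v) _) _.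
by rewrite expnS (mulnC 2) mulrnA mulr2n lerD.
Qed.

End Pair.

Lemma dem_demand l : @dem P l = demand l.
Proof. exact: input_demand. Qed.

Lemma color_setE l : @color_set P l = [set u | (enum_val u : points I) \in color l].
Proof.
apply/setP => u; rewrite !inE -[inp _ _]/(narr (input I) (g + (n * l + u))%N).
by rewrite input_color lt0b.
Qed.

Lemma outputE s (O : {set 'I_n}) : (forall u, narr s u != 0%N = (u \in O)) ->
  output I s = enum_val @: O.
Proof.
move=> h; apply/setP => x; rewrite inE h; apply/idP/imsetP => [xO|[u uO ->]].
  by exists (enum_rank x); rewrite ?enum_rankK.
by rewrite enum_valK.
Qed.

Lemma valid_solution u v (O : {set 'I_n}) : @valid_for P (n * u + v) O ->
  solution (rarr (input I) (n * u + v)%N *+ 4) (enum_val @: O : {set points I}).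
Proof.
case/andP => cardO /forallP cov; split.
- by rewrite mulrn_wge0 // input_dist_ge0.
- by rewrite card_imset //; exact: enum_val_inj.
move=> l; have := cov l; rewrite dem_demand => h; apply: leq_trans h _.
rewrite -(card_imset _ (@enum_val_inj _ predT)); apply: subset_leq_card.
apply/fintype.subsetP => _ /imsetP[w + ->]; rewrite inE color_setE.
case/andP; rewrite inE => wl /existsP[c /andP[cO cw]].
rewrite in_setI wl andbT; apply/bigcupP; exists (enum_val c); first exact: imset_f.
by rewrite inE; move: cw; rewrite nearbyE.
Qed.

(** Rounding [r] down to the largest pairwise distance not above it does not change any ball. *)
Lemma solution_pair r (C : {set points I}) : (0 < n)%N -> solution r C ->
  exists u v, rarr (input I) (n * u + v)%N <= r /\
    (#|[set c : 'I_n | (enum_val c : points I) \in C]| <= ncenters I)%N /\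
    forall l, (@dem P l <=
      #|ball1 (@nearby P 0 (n * u + v)) [set c : 'I_n | (enum_val c : points I)
        \in C] :&: @color_set P l|)%N.
Proof.
move=> n0 [r0 cardC cov].
pose o : 'I_n := Ordinal n0.
pose F (q : 'I_n * 'I_n) := rarr (input I) (n * q.1 + q.2)%N.
have FE a b : F (a, b) = mdist (enum_val a : points I) (enum_val b).
  by rewrite -input_dist.
have Fo : F (o, o) <= r by rewrite /F input_dist mdistxx.
(* The pair [(o, o)], at distance 0, shows that some distance is at most [r]. *)
have [q qr qmax] : exists2 q, F q <= r & forall q', F q' <= r -> F q' <= F q.
  case: (@Order.TotalTheory.arg_maxP _ _ _ (o, o) (fun q => F q <= r) F Fo) =>
    q qr qmax.
  by exists q.
exists q.1, q.2; split; first exact: qr.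
split.
  rewrite -(card_imset _ (@enum_val_inj _ predT)); apply: leq_trans cardC.
  by apply: subset_leq_card; apply/fintype.subsetP => _ /imsetP[c + ->]; rewrite inE.
move=> l; rewrite dem_demand; apply: leq_trans (cov l) _.
rewrite -(card_imset _ (@enum_rank_inj _)); apply: subset_leq_card.
apply/fintype.subsetP => _ /imsetP[x /setIP[/bigcupP[c cC cx] xl] ->].
rewrite inE color_setE [X in _ && X]inE enum_rankK xl andbT inE.
apply/existsP; exists (enum_rank c); rewrite inE enum_rankK cC nearbyE !enum_rankK.
rewrite inE in cx; have := qmax (enum_rank c, enum_rank x).
by rewrite FE !enum_rankK expn0 mulr1n; exact.
Qed.

End Instance.

Theorem theorem1 :
  exists (p : program) (c : nat), forall (R : realType) (I : instance R),
    exists (t : nat) (s : state R),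
      [/\ exec p (input I) t s,
          (t <= c * (#|points I| ^ (c * ncolors I)).+1)%N,
          (#|output I s| <= ncenters I)%N
        & forall rstar : R, optimal_radius I rstar ->
            exists2 r : R, r <= 4 * rstar & solution r (output I s)].
Proof.
have [C0 [D0 costP]] := algorithm_cost_poly.
(* The cost is at most [C0 * K.+1 ^ D0] with [K.+1 <= n ^ (9 * g)]; the summand 5 pays for the
   constant time spent on at most one point. *)
exists algorithm, (C0 + 9 * D0 + 5)%N => R I.
set n := #|points I|; set g := ncolors I; set c := (_ + _ + 5)%N.
set s0 := set_nreg (input I) 4 1.
have g0 : (0 < g)%N := ncolors_gt0 I; have k0 := ncenters_gt0 I.
have first_step : exec (Do (NConst 4 1)) (input I) 1 s0.
  have -> : s0 = run_instr (NConst 4 1) (input I) by rewrite run_instrE.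
  exact: exec_do.
have [n_le1|n_gt1] := leqP n 1.
  (* With at most one point the program marks cell 0, thus returns all points, which have radius
     0. *)
  set s1 := run_instr (NStore 7 4) (run_instr (NConst 7 0) s0).
  have outT : output I s1 = [set: points I].
    apply/setP => x; rewrite !inE /s1 run_storeE run_instrE [narr _ _]/= /update.
    have -> : enum_rank x = 0%N :> nat.
      by apply/eqP; rewrite -leqn0 -ltnS; apply: leq_trans (ltn_ord _) n_le1.
    by [].
  have cardT : (#|[set: points I]| <= ncenters I)%N.
    by rewrite cardsT; apply: leq_trans k0.
  exists (1 + (1 + 1).+1)%N, s1; split.
  - apply: exec_seq first_step _; apply: exec_if_true => //.
    by apply: exec_seq; exact: exec_do.
  - by rewrite mulnS; apply: leq_trans (leq_addr _ _); rewrite /c; lia.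
  - by rewrite outT.
  move=> rstar [[C [r0 _ cov]] _]; exists 0; first by rewrite mulr_ge0.
  split=> //; rewrite outT // => l; apply: leq_trans (cov l) _.
  apply: subset_leq_card; apply: setSI; apply/fintype.subsetP => x _.
  by apply/bigcupP; exists x; rewrite ?inE ?mdistxx.
set P := params_of I.
pose P0 := Params n g (ncenters I) 0 (narr (input I)) (dle P).
have r0 : repr (rarr (input I)) P0 (fun=> 0%N) (fun a i => narr (input I) (16 *
  i + array_id a)) s0.
  by split=> // v; rewrite /= /update /vreg; do 4?case: v => [|v] //=; rewrite nth_nil.
set K := ncode P.
have nK : (n <= K)%N.
  by apply: (@n_le_code P).
have gK : (g <= K)%N by have := room (P := P) n_gt1 erefl; rewrite -/K /=; lia.
have leM b : (bval P b <= K)%N by case: b.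
have [m0 step1] : exists m0, achieves compute_codes s0
    (1 + (times_base_cost K + (times_base_cost K + (times_base_cost K +
    ((K * (times_base_cost K + 4) + 6) + 1)))))
    (fun s' => repr (rarr (input I)) P (fun=> 0%N) m0 s').
  eexists; exact: (@compute_codes_ok _ _ P0 _ _ _ K nK gK erefl r0).
have main : achieves (Seq compute_codes (Seq (ccomp 0 search) write_out)) s0
    (algorithm_cost K - 2) (fun s' => forall i, (i < n)%N -> narr s' i = run P
      (fun=> 0%N) search m0 Out i).
  rewrite /algorithm_cost -addnA addKn.
  apply: achieves_seq step1 _ => s1 r1.
  apply: achieves_seq (ccomp_ok leM search 0 r1) _ => s2 [r2 _].
  exact: (write_out_ok (P := P) leM nK r2).
have [t [s [ex le_t outE]]] := main.
set m := run P _ search m0 in outE.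
pose O := [set u : 'I_n | 0 < m Out u]%N.
have outO : output I s = enum_val @: O.
  by apply: outputE => u; rewrite outE // inE lt0n.
have dle0 a b : dle P 0 a b = (rarr (input I) b <= rarr (input I) a).
  by rewrite /= expn0 mulr1n.
have dle_refl q : dle P 0 q q by rewrite dle0.
have dle_trans a b q : dle P 0 a b -> dle P 0 b q -> dle P 0 a q.
  by rewrite !dle0 => h1 h2; exact: le_trans h2 h1.
have dle_total a b : dle P 0 a b || dle P 0 b a by rewrite !dle0 le_total.
have sm : sound P m by apply: search_sound.
exists (1 + t.+1)%N, s; split.
- apply: exec_seq first_step _; apply: exec_if_false => //=.
  by rewrite /update /= -ltnNge.
(* As [n] is at least 2, [n + 1 <= n ^ 2] and so [K.+1 <= n ^ (2 * g + 7)]; as [g] is at least 1,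
   this exponent is at most [9 * g]. *)
- have lt_K : (K.+1 <= n ^ (9 * g))%N.
    apply: (@leq_trans (n ^ (2 * (g + 3)).+1)); last by rewrite leq_exp2l //; lia.
    have leK : (K <= n ^ (2 * (g + 3)))%N.
      by rewrite expnM leq_exp2r ?addn_gt0 ?orbT // expnS expn1; nia.
    have n_pos : (0 < n ^ (2 * (g + 3)))%N by rewrite expn_gt0 ltnW.
    by rewrite expnS; nia.
  have cost2 : (2 <= algorithm_cost K)%N by rewrite /algorithm_cost -!addnA leq_addr.
  apply: (@leq_trans (algorithm_cost K)); first by lia.
  apply: leq_trans (costP K) _; apply: leq_mul; first by rewrite /c; lia.
  apply: leq_trans (leqnSn _); apply: (@leq_trans ((n ^ (9 * g)) ^ D0)).
    by case: (D0) => [|D]; rewrite ?expn0 ?leq_exp2r.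
  by rewrite -expnM leq_exp2l // /c; nia.
- rewrite outO card_imset; last exact: enum_val_inj.
  move: sm; rewrite /sound; case: ifP => [_ [u [v [_ /andP[]]]]//|_].
  by rewrite -/O => ->; rewrite cards0.
move=> rstar [[C solC] _].
have [u [v [le_r [cardC cov]]]] := solution_pair (ltnW n_gt1) solC.
have [F0 le_best] : good P (n * u + v) m.
  apply: (@search_good P n_gt1 g0 erefl dle_refl dle_trans dle_total _ _ u v
    [set c : 'I_n | (enum_val c : points I) \in C]).
  - exact: nearby_sym.
  - exact: nearby_sym.
  - exact: nearby_sym.
  - exact: nearby_refl.
  - exact: nearby_weaken.
  - exact: nearby_weaken.
  - exact: nearby_trans.
  - exact: nearby_trans.
  - exact: cardC.
  - exact: cov.
(* The stored distance is at most that of the pair [(u, v)], hence at most [rstar], and the stored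
   set is valid at four times this distance. *)
move: sm; rewrite /sound F0 -/O => -[u' [v' [eB val]]].
rewrite eB in val le_best; exists (rarr (input I) (n * u' + v')%N *+ 4).
  rewrite -[leLHS]mulr_natl ler_wpM2l //; apply: le_trans le_r; rewrite -dle0;
    exact: le_best.
by rewrite outO; exact: valid_solution val.
Qed.
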